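(* Let $\varepsilon$ be a generic real parameter and let $D=\mathbb{C}[X_1,X_2,Y]\langle\partial_{X_1},\partial_{X_2},\partial_Y\rangle$ be the Weyl algebra in the variables $X_1,X_2,Y$, with $R=\mathbb{C}(X_1,X_2,Y)\langle\partial_{X_1},\partial_{X_2},\partial_Y\rangle$ the corresponding rational Weyl algebra. Let $$\Delta_1=(X_1^2-Y^2)\partial_{X_1}^2+2(1-\varepsilon)X_1\partial_{X_1}-\varepsilon(1-\varepsilon),$$ $$\Delta_2=(X_2^2-Y^2)\partial_{X_2}^2+2(1-\varepsilon)X_2\partial_{X_2}-\varepsilon(1-\varepsilon),$$ $$\Delta_3=(X_1+Y)(X_2+Y)\partial_{X_1}\partial_{X_2}-\varepsilon(X_1+Y)\partial_{X_1}-\varepsilon(X_2+Y)\partial_{X_2}+\varepsilon^2,$$ $$H=X_1\partial_{X_1}+X_2\partial_{X_2}+Y\partial_Y-2\varepsilon,$$ and let $I=\langle \Delta_1+\Delta_3,\ \Delta_2+\Delta_3,\ H\rangle$ be the left $D$-ideal generated by these three operators. Let $H_A^{\mathrm{res}}(\kappa)\subset D$ be the restricted GKZ system of the two-site chain (defined in the context). Then the left $D$-ideal $DIY=\{PY \mid P\in I\}$ (where $PY$ is the product in $D$ of $P$ with the multiplication operator $Y$) is contained in $H_A^{\mathrm{res}}(\kappa)$: $$DIY\subset H_A^{\mathrm{res}}(\kappa).$$ Moreover, the two ideals coincide when considered as ideals in the rational Weyl algebra, i.e. the left $R$-ideals generated by $DIY$ and by $H_A^{\mathrm{res}}(\kappa)$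 are equal.
   Context: Weyl algebras: in $\mathbb{C}[x_1,\dots,x_n]\langle\partial_{x_1},\dots,\partial_{x_n}\rangle$ all generators commute except $\partial_{x_i}x_i-x_i\partial_{x_i}=1$; the rational Weyl algebra allows coefficients in the rational function field $\mathbb{C}(x_1,\dots,x_n)$. ''$D$-ideal'' always means left $D$-ideal. GKZ system of the two-site chain. It is the GKZ system attached to the integral $\int_\Gamma \frac{1}{(c_1\alpha_1+c_2\alpha_2+c_3)(c_4\alpha_1+c_5)(c_6\alpha_2+c_7)}\,\alpha_1^{\varepsilon+1}\alpha_2^{\varepsilon+1}\frac{d\alpha_1}{\alpha_1}\frac{d\alpha_2}{\alpha_2}$ with parameter vector $\kappa=(-(\varepsilon+1),-(\varepsilon+1),-1,-1,-1)^\top$. Explicitly, let $D_A=\mathbb{C}[c_1,\dots,c_7]\langle\partial_{c_1},\dots,\partial_{c_7}\rangle$ and $\theta_{c_i}=c_i\partial_{c_i}$. Then $H_A(\kappa)=I_A+J_{A,\kappa}$ is the left $D_A$-ideal generated by the toric operators $$\partial_{c_2}\partial_{c_7}-\partial_{c_3}\partial_{c_6},\qquad \partial_{c_1}\partial_{c_5}-\partial_{c_3}\partial_{c_4}$$ (generating $I_A$) and the Euler-type operators (generating $J_{A,\kappa}$) $$\theta_{c_1}+\theta_{c_4}+(\varepsilon+1),\quad \theta_{c_2}+\theta_{c_6}+(\varepsilon+1),\quad \theta_{c_1}+\theta_{c_2}+\theta_{c_3}+1,\quad \theta_{c_4}+\theta_{c_5}+1,\quad \theta_{c_6}+\theta_{c_7}+1.$$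 Restriction ideal. For a left ideal $K$ of $D_n=\mathbb{C}[x_1,\dots,x_n]\langle\partial_{x_1},\dots,\partial_{x_n}\rangle$ and $m<n$, the restriction ideal of $K$ to $\{x_{m+1}=\dots=x_n=0\}$ is the left $D_m$-ideal $(K+x_{m+1}D_n+\dots+x_nD_n)\cap D_m$, where $D_m$ is the Weyl algebra in $x_1,\dots,x_m$. Restriction to an affine subspace such as $\{c_1=c_2=c_4=c_6=1\}$ is defined in the same way after translating coordinates, i.e. it is the left ideal $$\bigl(H_A(\kappa)+(c_1-1)D_A+(c_2-1)D_A+(c_4-1)D_A+(c_6-1)D_A\bigr)\cap \mathbb{C}[c_3,c_5,c_7]\langle\partial_{c_3},\partial_{c_5},\partial_{c_7}\rangle.$$ Restricted GKZ system. $H_A^{\mathrm{res}}(\kappa)\subset D$ is the left ideal obtained from the restriction of $H_A(\kappa)$ to $\{c\in\mathbb{C}^7\mid c_1=c_2=c_4=c_6=1\}$ by the invertible linear change of variables $c_3=X_1+X_2$, $c_5=X_1+Y$, $c_7=X_2+Y$ (with the induced change of the derivations: $\partial_{X_1}=\partial_{c_3}+\partial_{c_5}$, $\partial_{X_2}=\partial_{c_3}+\partial_{c_7}$, $\partial_Y=\partial_{c_5}+\partial_{c_7}$). *)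

(* Defs.v *)
From HB Require Import structures.
From mathcomp Require Import all_boot all_order all_algebra.
From mathcomp Require Import mpoly complex.
From mathcomp Require Import boolp classical_sets reals.

Set Implicit Arguments.
Unset Strict Implicit.
Unset Printing Implicit Defensive.

Import GRing.Theory.
Local Open Scope quotient_scope.
Local Open Scope classical_set_scope.
Local Open Scope complex_scope.
Local Open Scope ring_scope.

(******************************************************************************)
(* Weyl algebras by generators and relations.  The coefficient ring K is a    *)
(* commutative ring over the scalars C (through cst : C -> K) with            *)
(* distinguished coordinates x_1, ..., x_n.  [weyl cst x] is the ring         *)
(* generated by the ring K and by d_1, ..., d_n subject only to               *)
(*    d_i d_j = d_j d_i,  d_i c = c d_i (c a scalar),  d_i x_j - x_j d_i =    *)
(*    delta_ij.                                                               *)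
(* For K = C[x_1..x_n] this is the Weyl algebra, for K = C(x_1..x_n) it is    *)
(* the rational Weyl algebra: since every element of K is obtained from       *)
(* scalars and coordinates by ring operations and inverses, the relations     *)
(* force d_i f - f d_i to be the partial derivative of f, for all f in K.     *)
(******************************************************************************)

Inductive wterm (K : Type) (n : nat) : Type :=
| WCoef of K
| WDer of 'I_n
| WAdd of wterm K n & wterm K n
| WOpp of wterm K n
| WMul of wterm K n & wterm K n.

Arguments WDer K {n}.

Section Weyl.
Variables (C : pzRingType) (K : comPzRingType) (n : nat).
Variables (cst : C -> K) (x : 'I_n -> K).

Local Notation term := (wterm K n).
Local Notation "s +t t" := (WAdd s t) (at level 50, left associativity).
Local Notation "s *t t" := (WMul s t) (at level 40, left associativity).
Local Notation cf a := (WCoef n a).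
Local Notation d i := (WDer K i).

Inductive weqv : term -> term -> Prop :=
| weqv_refl s : weqv s s
| weqv_sym s t : weqv s t -> weqv t s
| weqv_trans s t u : weqv s t -> weqv t u -> weqv s u
| weqv_add s s' t t' : weqv s s' -> weqv t t' -> weqv (s +t t) (s' +t t')
| weqv_opp s s' : weqv s s' -> weqv (WOpp s) (WOpp s')
| weqv_mul s s' t t' : weqv s s' -> weqv t t' -> weqv (s *t t) (s' *t t')
| weqv_addA s t u : weqv (s +t (t +t u)) (s +t t +t u)
| weqv_addC s t : weqv (s +t t) (t +t s)
| weqv_add0 s : weqv (cf 0 +t s) s
| weqv_addN s : weqv (WOpp s +t s) (cf 0)
| weqv_mulA s t u : weqv (s *t (t *t u)) (s *t t *t u)
| weqv_mul1l s : weqv (cf 1 *t s) s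
| weqv_mul1r s : weqv (s *t cf 1) s
| weqv_mulDl s t u : weqv ((s +t t) *t u) (s *t u +t t *t u)
| weqv_mulDr s t u : weqv (s *t (t +t u)) (s *t t +t s *t u)
| weqv_coefD a b : weqv (cf (a + b)) (cf a +t cf b)
| weqv_coefM a b : weqv (cf (a * b)) (cf a *t cf b)
| weqv_derC i j : weqv (d i *t d j) (d j *t d i)
| weqv_der_cst i c : weqv (d i *t cf (cst c)) (cf (cst c) *t d i)
| weqv_der_var i j :
    weqv (d i *t cf (x j)) (cf (x j) *t d i +t cf ((i == j)%:R)).

HB.instance Definition _ := gen_eqMixin term.
HB.instance Definition _ := gen_choiceMixin term.

Definition weqvb (s t : term) : bool := `[< weqv s t >].

Lemma weqvb_refl : reflexive weqvb.
Proof. by move=> s; apply/asboolP; exact: weqv_refl. Qed.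

Lemma weqvb_sym : ssrbool.symmetric weqvb.
Proof. by move=> s t; apply/asboolP/asboolP; exact: weqv_sym. Qed.

Lemma weqvb_trans : transitive weqvb.
Proof.
by move=> t s u /asboolP st /asboolP tu; apply/asboolP; exact: weqv_trans st tu.
Qed.

Canonical weqv_equiv := EquivRel weqvb weqvb_refl weqvb_sym weqvb_trans.

Definition weyl : Type := {eq_quot weqv_equiv}.

HB.instance Definition _ := Choice.on weyl.
HB.instance Definition _ := EqQuotient.on weyl.

Definition wpi (t : term) : weyl := \pi_weyl t.

Lemma wpiP s t : wpi s = wpi t <-> weqv s t.
Proof.
split=> [/eqP|st]; first by rewrite piE => /asboolP.
by apply/eqP; rewrite piE; apply/asboolP.
Qed.

Lemma wreprP t : weqv (repr (wpi t)) t.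
Proof. by apply/wpiP; rewrite /wpi reprK. Qed.

Lemma wpiW (P : weyl -> Prop) : (forall t, P (wpi t)) -> forall a, P a.
Proof. by move=> Pt a; rewrite -[a]reprK; exact: Pt. Qed.

Definition weyl_add (a b : weyl) := wpi (repr a +t repr b).
Definition weyl_opp (a : weyl) := wpi (WOpp (repr a)).
Definition weyl_mul (a b : weyl) := wpi (repr a *t repr b).

Lemma wpiD s t : weyl_add (wpi s) (wpi t) = wpi (s +t t).
Proof. by apply/wpiP; apply: weqv_add; exact: wreprP. Qed.

Lemma wpiN s : weyl_opp (wpi s) = wpi (WOpp s).
Proof. by apply/wpiP; apply: weqv_opp; exact: wreprP. Qed.

Lemma wpiM s t : weyl_mul (wpi s) (wpi t) = wpi (s *t t).
Proof. by apply/wpiP; apply: weqv_mul; exact: wreprP. Qed.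

Local Lemma weyl_addA : associative weyl_add.
Proof.
elim/wpiW=> s; elim/wpiW=> t; elim/wpiW=> u.
by rewrite !wpiD; apply/wpiP; exact: weqv_addA.
Qed.

Local Lemma weyl_addC : commutative weyl_add.
Proof.
elim/wpiW=> s; elim/wpiW=> t.
by rewrite !wpiD; apply/wpiP; exact: weqv_addC.
Qed.

Local Lemma weyl_add0 : left_id (wpi (cf 0)) weyl_add.
Proof. by elim/wpiW=> s; rewrite wpiD; apply/wpiP; exact: weqv_add0. Qed.

Local Lemma weyl_addN : left_inverse (wpi (cf 0)) weyl_opp weyl_add.
Proof. by elim/wpiW=> s; rewrite wpiN wpiD; apply/wpiP; exact: weqv_addN. Qed.

HB.instance Definition _ :=
  GRing.isZmodule.Build weyl weyl_addA weyl_addC weyl_add0 weyl_addN.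

Local Lemma weyl_mulA : associative weyl_mul.
Proof.
elim/wpiW=> s; elim/wpiW=> t; elim/wpiW=> u.
by rewrite !wpiM; apply/wpiP; exact: weqv_mulA.
Qed.

Local Lemma weyl_mul1l : left_id (wpi (cf 1)) weyl_mul.
Proof. by elim/wpiW=> s; rewrite wpiM; apply/wpiP; exact: weqv_mul1l. Qed.

Local Lemma weyl_mul1r : right_id (wpi (cf 1)) weyl_mul.
Proof. by elim/wpiW=> s; rewrite wpiM; apply/wpiP; exact: weqv_mul1r. Qed.

Local Lemma weyl_mulDl : left_distributive weyl_mul weyl_add.
Proof.
elim/wpiW=> s; elim/wpiW=> t; elim/wpiW=> u.
by rewrite !(wpiD, wpiM); apply/wpiP; exact: weqv_mulDl.
Qed.

Local Lemma weyl_mulDr : right_distributive weyl_mul weyl_add.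
Proof.
elim/wpiW=> s; elim/wpiW=> t; elim/wpiW=> u.
by rewrite !(wpiD, wpiM); apply/wpiP; exact: weqv_mulDr.
Qed.

HB.instance Definition _ :=
  GRing.Zmodule_isPzRing.Build weyl
    weyl_mulA weyl_mul1l weyl_mul1r weyl_mulDl weyl_mulDr.

Definition wcoef (a : K) : weyl := wpi (cf a).
Definition wder (i : 'I_n) : weyl := wpi (d i).

Lemma wcoefD a b : wcoef (a + b) = wcoef a + wcoef b.
Proof. by rewrite /wcoef [RHS]wpiD; apply/wpiP; exact: weqv_coefD. Qed.

Lemma wcoefM a b : wcoef (a * b) = wcoef a * wcoef b.
Proof. by rewrite /wcoef [RHS]wpiM; apply/wpiP; exact: weqv_coefM. Qed.

Local Lemma wcoef_zmod_morphism : zmod_morphism wcoef.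
Proof. by move=> a b; apply/eqP; rewrite eq_sym subr_eq -wcoefD subrK. Qed.

Local Lemma wcoef_monoid_morphism : monoid_morphism wcoef.
Proof. by split=> // a b; exact: wcoefM. Qed.

HB.instance Definition _ :=
  GRing.isZmodMorphism.Build K weyl wcoef wcoef_zmod_morphism.
HB.instance Definition _ :=
  GRing.isMonoidMorphism.Build K weyl wcoef wcoef_monoid_morphism.

Lemma wderC i j : wder i * wder j = wder j * wder i.
Proof. by rewrite [LHS]wpiM [RHS]wpiM; apply/wpiP; exact: weqv_derC. Qed.

Lemma wder_cst i c : wder i * wcoef (cst c) = wcoef (cst c) * wder i.
Proof. by rewrite [LHS]wpiM [RHS]wpiM; apply/wpiP; exact: weqv_der_cst. Qed.

Lemma wder_var i j :
  wder i * wcoef (x j) = wcoef (x j) * wder i + (i == j)%:R.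
Proof.
have <- : wcoef (i == j)%:R = (i == j)%:R by rewrite rmorph_nat.
rewrite [LHS]wpiM [wcoef _ * _]wpiM [RHS]wpiD.
by apply/wpiP; exact: weqv_der_var.
Qed.

(* Universal property: a ring morphism f on the coefficients and elements e_i *)
(* satisfying the Weyl relations extend to a ring morphism on [weyl].         *)
Section Lift.
Variables (A : pzRingType) (f : {rmorphism K -> A}) (e : 'I_n -> A).

Fixpoint weval (t : term) : A :=
  match t with
  | WCoef a => f a
  | WDer i => e i
  | WAdd s t => weval s + weval t
  | WOpp s => - weval s
  | WMul s t => weval s * weval t
  end.

Definition wlift (P : weyl) : A := weval (repr P).

Definition wlift_spec : Prop :=
  [/\ forall i j, e i * e j = e j * e i,
      forall i c, e i * f (cst c) = f (cst c) * e i
    & forall i j, e i * f (x j) = f (x j) * e i + (i == j)%:R].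

Hypothesis fe : wlift_spec.

Lemma weval_eqv s t : weqv s t -> weval s = weval t.
Proof.
case: fe => eC ec ex; elim=> //=.
- by move=> ? ? ? _ -> _ ->.
- by move=> ? ? ? ? _ -> _ ->.
- by move=> ? ? _ ->.
- by move=> ? ? ? ? _ -> _ ->.
- by move=> *; rewrite addrA.
- by move=> *; rewrite addrC.
- by move=> *; rewrite rmorph0 add0r.
- by move=> *; rewrite rmorph0 addNr.
- by move=> *; rewrite mulrA.
- by move=> *; rewrite rmorph1 mul1r.
- by move=> *; rewrite rmorph1 mulr1.
- by move=> *; rewrite mulrDl.
- by move=> *; rewrite mulrDr.
- by move=> *; rewrite rmorphD.
- by move=> *; rewrite rmorphM.
- by move=> i j; rewrite rmorph_nat ex.
Qed.

Lemma wlift_pi t : wlift (wpi t) = weval t.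
Proof. by apply: weval_eqv; exact: wreprP. Qed.

Lemma wlift_coef a : wlift (wcoef a) = f a.
Proof. exact: wlift_pi. Qed.

Lemma wlift_der i : wlift (wder i) = e i.
Proof. exact: wlift_pi. Qed.

Lemma wlift_zmod_morphism : zmod_morphism wlift.
Proof.
elim/wpiW=> s; elim/wpiW=> t.
by rewrite [- wpi t]wpiN [_ + _]wpiD !wlift_pi.
Qed.

Lemma wlift_monoid_morphism : monoid_morphism wlift.
Proof.
split; first by rewrite wlift_coef rmorph1.
by elim/wpiW=> s; elim/wpiW=> t; rewrite [_ * _]wpiM !wlift_pi.
Qed.

End Lift.
End Weyl.

Section WeylAlgebras.
Variable C : fieldType.

Definition weyl_poly (n : nat) : pzRingType :=
  weyl (@mpolyC n C) (fun i : 'I_n => 'X_i).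

Definition weyl_rat (n : nat) : pzRingType :=
  weyl (fun c : C => tofrac (@mpolyC n C c))
       (fun i : 'I_n => tofrac ('X_i : {mpoly C[n]})).

Definition wpoly (n : nat) (p : {mpoly C[n]}) : weyl_poly n := wcoef _ _ p.
Definition wscal (n : nat) (c : C) : weyl_poly n := wpoly c%:MP.
Definition wvar (n : nat) (i : 'I_n) : weyl_poly n := wpoly 'X_i.
Definition wpartial (n : nat) (i : 'I_n) : weyl_poly n := wder _ _ i.

HB.instance Definition _ n := GRing.RMorphism.copy (@wpoly n) (wcoef _ _).

Lemma wpartial_var n (i j : 'I_n) :
  wpartial i * wvar j = wvar j * wpartial i + (i == j)%:R.
Proof. exact: wder_var. Qed.

Lemma wpartialC n (i j : 'I_n) :
  wpartial i * wpartial j = wpartial j * wpartial i.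
Proof. exact: wderC. Qed.

Lemma wpolyC n (p q : {mpoly C[n]}) : wpoly p * wpoly q = wpoly q * wpoly p.
Proof. by rewrite -!rmorphM mulrC. Qed.

Lemma wscalC n (c : C) (P : weyl_poly n) : P * wscal n c = wscal n c * P.
Proof.
elim/wpiW: P; elim=> [p|i|s IHs t IHt|s IHs|s IHs t IHt].
- exact: wpolyC.
- exact: wder_cst.
- by rewrite -[wpi _ _ (WAdd s t)]wpiD mulrDl mulrDr IHs IHt.
- by rewrite -[wpi _ _ (WOpp s)]wpiN mulNr mulrN IHs.
- by rewrite -[wpi _ _ (WMul s t)]wpiM -mulrA IHt mulrA IHs mulrA.
Qed.

Definition to_rat (n : nat) : weyl_poly n -> weyl_rat n :=
  wlift (wcoef _ _ \o @tofrac {mpoly C[n]}) (wder _ _).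

Lemma to_rat_spec n :
  wlift_spec (@mpolyC n C) (fun i : 'I_n => 'X_i)
    (wcoef (fun c : C => tofrac (@mpolyC n C c))
       (fun i : 'I_n => tofrac ('X_i : {mpoly C[n]})) \o @tofrac {mpoly C[n]})
    (wder _ _).
Proof.
split=> [i j|i c|i j] /=; [exact: wderC|exact: wder_cst|exact: wder_var].
Qed.

HB.instance Definition _ n := GRing.isZmodMorphism.Build
  (weyl_poly n) (weyl_rat n) (@to_rat n)
  (wlift_zmod_morphism (@to_rat_spec n)).
HB.instance Definition _ n := GRing.isMonoidMorphism.Build
  (weyl_poly n) (weyl_rat n) (@to_rat n)
  (wlift_monoid_morphism (@to_rat_spec n)).

End WeylAlgebras.

Section LeftIdeals.
Variable A : pzRingType.

Definition left_ideal (I : set A) : Prop :=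
  [/\ I 0, forall P Q, I P -> I Q -> I (P + Q) & forall P Q, I Q -> I (P * Q)].

Definition left_ideal_gen (S : set A) : set A := smallest left_ideal S.

Definition ideal_sum (I J : set A) : set A := [set P + Q | P in I & Q in J].

Lemma left_ideal_genP (S : set A) : left_ideal (left_ideal_gen S).
Proof.
split=> [I [[]]//|P Q IP IQ I ISI|P Q IQ I ISI].
- by case: (ISI) => -[_ ID _] _; apply: ID; [exact: IP|exact: IQ].
- by case: (ISI) => -[_ _ IM] _; apply: IM; exact: IQ.
Qed.

Lemma sub_left_ideal_gen (S : set A) : S `<=` left_ideal_gen S.
Proof. exact: sub_gen_smallest. Qed.

End LeftIdeals.

(* A property of a real parameter holds generically if it holds on a nonempty *)
(* Zariski open subset of the affine line, i.e. away from the zeros of some   *)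
(* nonzero polynomial.                                                        *)
Definition generically (R : realType) (P : R -> Prop) : Prop :=
  exists2 p : {poly R}, p != 0 & forall eps, p.[eps] != 0 -> P eps.

Section TwoSiteChain.
Variable R : realType.
Local Notation C := R[i].

(* The variables are numbered from 1, as in c_1, ..., c_7. *)
Local Notation ord n k := (@Ordinal n k.-1 isT).
Local Notation c k := (wvar C (ord 7 k)).
Local Notation dc k := (wpartial C (ord 7 k)).
Local Notation theta k := (c k * dc k).

Definition toric_ideal : set (weyl_poly C 7) :=
  left_ideal_gen [set dc 2 * dc 7 - dc 3 * dc 6; dc 1 * dc 5 - dc 3 * dc 4].

Definition euler_ideal (eps : R) : set (weyl_poly C 7) :=
  let e := wscal 7 (eps%:C : C) in
  left_ideal_gen
    [set theta 1 + theta 4 + (e + 1); theta 2 + theta 6 + (e + 1);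
         theta 1 + theta 2 + theta 3 + 1; theta 4 + theta 5 + 1;
         theta 6 + theta 7 + 1].

Definition gkz_ideal (eps : R) : set (weyl_poly C 7) :=
  ideal_sum toric_ideal (euler_ideal eps).

(* The inclusion of C[c_3,c_5,c_7]<d_3,d_5,d_7>, viewed as the Weyl algebra   *)
(* in three variables, into C[c_1..c_7]<d_1..d_7>.                            *)
Definition sel357 : 3.-tuple 'I_7 := [tuple ord 7 3; ord 7 5; ord 7 7].

Definition incl357 : weyl_poly C 3 -> weyl_poly C 7 :=
  wlift (wcoef _ _ \o comp_mpoly [tuple 'X_(tnth sel357 i) | i < 3])
        (fun i => wpartial C (tnth sel357 i)).

Lemma incl357_spec :
  wlift_spec (@mpolyC 3 C) (fun i => 'X_i)
    (wcoef (@mpolyC 7 C) (fun i => 'X_i)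
       \o comp_mpoly [tuple 'X_(tnth sel357 i) | i < 3])
    (fun i => wpartial C (tnth sel357 i)).
Proof.
split=> [i j|i a|i j]; first exact: wderC.
  by rewrite /= comp_mpolyC; exact: wder_cst.
rewrite /= comp_mpolyXU -tnth_nth tnth_mktuple wder_var (inj_eq _) //.
by apply/tuple_uniqP.
Qed.

HB.instance Definition _ := GRing.isZmodMorphism.Build
  (weyl_poly C 3) (weyl_poly C 7) incl357 (wlift_zmod_morphism incl357_spec).
HB.instance Definition _ := GRing.isMonoidMorphism.Build
  (weyl_poly C 3) (weyl_poly C 7) incl357 (wlift_monoid_morphism incl357_spec).

Definition gkz_restriction (eps : R) : set (weyl_poly C 3) :=
  [set P | exists2 h, gkz_ideal eps h &
     exists q1 q2 q4 q6 : weyl_poly C 7,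
       incl357 P = h + (c 1 - 1) * q1 + (c 2 - 1) * q2
                     + (c 4 - 1) * q4 + (c 6 - 1) * q6].

(* X_1, X_2, Y are the three variables of a second copy of the Weyl algebra. *)
Local Notation X1 := (wvar C (ord 3 1)).
Local Notation X2 := (wvar C (ord 3 2)).
Local Notation Y := (wvar C (ord 3 3)).
Local Notation dX1 := (wpartial C (ord 3 1)).
Local Notation dX2 := (wpartial C (ord 3 2)).
Local Notation dY := (wpartial C (ord 3 3)).
Local Notation half := (wscal 3 (2^-1 : C)).

(* c_3 = X_1 + X_2, c_5 = X_1 + Y, c_7 = X_2 + Y; the images of d_3, d_5, d_7 *)
(* are obtained by inverting d_X1 = d_3 + d_5, d_X2 = d_3 + d_7,              *)
(* d_Y = d_5 + d_7, see [cov_dX1], [cov_dX2], [cov_dY].                       *)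
Definition cov_coef : {mpoly C[3]} -> {mpoly C[3]} :=
  let X k := 'X_k : {mpoly C[3]} in
  comp_mpoly [tuple X (ord 3 1) + X (ord 3 2); X (ord 3 1) + X (ord 3 3);
                    X (ord 3 2) + X (ord 3 3)].

HB.instance Definition _ := GRing.RMorphism.copy cov_coef (comp_mpoly _).

Definition cov_der (i : 'I_3) : weyl_poly C 3 :=
  tnth [tuple half * (dX1 + dX2 - dY); half * (dX1 + dY - dX2);
              half * (dX2 + dY - dX1)] i.

Definition cov : weyl_poly C 3 -> weyl_poly C 3 :=
  wlift (wcoef _ _ \o cov_coef) cov_der.

Lemma half_double (P : weyl_poly C 3) : half * (P + P) = P.
Proof.
have two : (2^-1 : C)%:MP + 2^-1%:MP = 1 :> {mpoly C[3]}.
  rewrite -mpolyCD -mpolyC1; congr _%:MP.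
  by rewrite -mulr2n -[LHS]mulr_natl divff // Num.Theory.pnatr_eq0.
by rewrite mulrDr -mulrDl -rmorphD two rmorph1 mul1r.
Qed.

Local Lemma zmod_cancel (V : zmodType) (a b y : V) :
  a + b - y + (a + y - b) = a + a.
Proof.
rewrite -[a + b - y]addrA -[a + y - b]addrA addrACA.
by rewrite [b - y + _]addrA subrK subrr addr0.
Qed.

Local Lemma bracket_half (a b c u v : 'I_3) :
  half * (wpartial C a + wpartial C b - wpartial C c) * (wvar C u + wvar C v)
  = (wvar C u + wvar C v) *
      (half * (wpartial C a + wpartial C b - wpartial C c))
    + half * ((a == u)%:R + (a == v)%:R + ((b == u)%:R + (b == v)%:R)
              - ((c == u)%:R + (c == v)%:R)).
Proof.
have br i : wpartial C i * (wvar C u + wvar C v)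
    = (wvar C u + wvar C v) * wpartial C i + ((i == u)%:R + (i == v)%:R).
  by rewrite mulrDr mulrDl !wpartial_var addrACA.
rewrite -mulrA [in RHS]mulrA wscalC -[in RHS]mulrA -mulrDr; congr (_ * _).
by rewrite mulrBl mulrDl !br addrACA mulrBr mulrDr opprD [LHS]addrACA.
Qed.

Local Lemma half_count (A : pzRingType) (h : A) (b1 b2 b3 b4 b5 b6 b : bool) :
  h * (1 + 1) = 1 -> (b1 + b2 + (b3 + b4) == b5 + b6 + b.*2)%N ->
  h * (b1%:R + b2%:R + (b3%:R + b4%:R) - (b5%:R + b6%:R)) = b%:R.
Proof.
move=> h2 /eqP e; rewrite -!natrD e natrD [(b5 + b6)%:R + _]addrC addrK.
by rewrite -addnn; case: b {e} => //=; rewrite mulr0.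
Qed.

Local Lemma bracket_one (a b c u v i j : 'I_3) :
  ((a == u) + (a == v) + ((b == u) + (b == v))
    == (c == u) + (c == v) + (i == j).*2)%N ->
  half * (wpartial C a + wpartial C b - wpartial C c) *
    wpoly ('X_u + 'X_v) =
  wpoly ('X_u + 'X_v) *
    (half * (wpartial C a + wpartial C b - wpartial C c)) + (i == j)%:R.
Proof.
move=> e; rewrite rmorphD -(half_count (half_double 1) e).
exact: bracket_half.
Qed.

Lemma cov_spec :
  wlift_spec (@mpolyC 3 C) (fun i => 'X_i)
    (wcoef (@mpolyC 3 C) (fun i => 'X_i) \o cov_coef) cov_der.
Proof.
split=> [i j|i a|i j].
- have comm (a b c a' b' c' : 'I_3) :
      half * (wpartial C a + wpartial C b - wpartial C c) *
        (half * (wpartial C a' + wpartial C b' - wpartial C c'))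
    = half * (wpartial C a' + wpartial C b' - wpartial C c') *
        (half * (wpartial C a + wpartial C b - wpartial C c)).
    rewrite mulrA [half * _ * half]wscalC [RHS]mulrA [half * _ * half]wscalC.
    rewrite -!mulrA; do 2!congr (_ * _).
    have br k l : wpartial C l * wpartial C k = wpartial C k * wpartial C l.
      exact: wpartialC.
    have br3 k : wpartial C k * (wpartial C a' + wpartial C b' - wpartial C c')
      = (wpartial C a' + wpartial C b' - wpartial C c') * wpartial C k.
      by rewrite mulrBr mulrBl mulrDr mulrDl !(br _ k).
    by rewrite mulrBl mulrDl !br3 -mulrDr -mulrBr.
  by case: i => -[|[|[|//]]] hi; case: j => -[|[|[|//]]] hj;
     rewrite /cov_der !(tnth_nth 0); exact: comm.
- by rewrite /= /cov_coef comp_mpolyC; exact: wscalC.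
- rewrite /= /cov_coef comp_mpolyXU.
  case: i => -[|[|[|//]]] hi; case: j => -[|[|[|//]]] hj;
    rewrite /cov_der !(tnth_nth 0) /=;
    exact: (@bracket_one _ _ _ _ _ (Ordinal hi) (Ordinal hj)).
Qed.

HB.instance Definition _ := GRing.isZmodMorphism.Build
  (weyl_poly C 3) (weyl_poly C 3) cov (wlift_zmod_morphism cov_spec).
HB.instance Definition _ := GRing.isMonoidMorphism.Build
  (weyl_poly C 3) (weyl_poly C 3) cov (wlift_monoid_morphism cov_spec).

(* As c_3, c_5, c_7 are numbered 1, 2, 3, these say that d_3 + d_5 goes to    *)
(* d_X1, d_3 + d_7 to d_X2 and d_5 + d_7 to d_Y.                              *)
Lemma cov_dX1 : cov (wpartial C (ord 3 1) + wpartial C (ord 3 2)) = dX1.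
Proof.
rewrite rmorphD /= /cov !(wlift_der cov_spec) /cov_der !(tnth_nth 0) /= -mulrDr.
by rewrite -[RHS]half_double zmod_cancel.
Qed.

Lemma cov_dX2 : cov (wpartial C (ord 3 1) + wpartial C (ord 3 3)) = dX2.
Proof.
rewrite rmorphD /= /cov !(wlift_der cov_spec) /cov_der !(tnth_nth 0) /= -mulrDr.
by rewrite -[RHS]half_double [dX1 + dX2]addrC zmod_cancel.
Qed.

Lemma cov_dY : cov (wpartial C (ord 3 2) + wpartial C (ord 3 3)) = dY.
Proof.
rewrite rmorphD /= /cov !(wlift_der cov_spec) /cov_der !(tnth_nth 0) /= -mulrDr.
by rewrite -[RHS]half_double [dX1 + dY]addrC [dX2 + dY]addrC zmod_cancel.
Qed.

Definition gkz_res (eps : R) : set (weyl_poly C 3) :=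
  cov @` gkz_restriction eps.

Definition Delta1 (eps : R) : weyl_poly C 3 :=
  let e := wscal 3 (eps%:C : C) in
  (X1 ^+ 2 - Y ^+ 2) * dX1 ^+ 2 + 2%:R * (1 - e) * X1 * dX1 - e * (1 - e).

Definition Delta2 (eps : R) : weyl_poly C 3 :=
  let e := wscal 3 (eps%:C : C) in
  (X2 ^+ 2 - Y ^+ 2) * dX2 ^+ 2 + 2%:R * (1 - e) * X2 * dX2 - e * (1 - e).

Definition Delta3 (eps : R) : weyl_poly C 3 :=
  let e := wscal 3 (eps%:C : C) in
  (X1 + Y) * (X2 + Y) * dX1 * dX2 - e * (X1 + Y) * dX1 - e * (X2 + Y) * dX2
  + e ^+ 2.

Definition Hop (eps : R) : weyl_poly C 3 :=
  let e := wscal 3 (eps%:C : C) in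
  X1 * dX1 + X2 * dX2 + Y * dY - 2%:R * e.

Definition ideal_I (eps : R) : set (weyl_poly C 3) :=
  left_ideal_gen
    [set Delta1 eps + Delta3 eps; Delta2 eps + Delta3 eps; Hop eps].

Definition ideal_DIY (eps : R) : set (weyl_poly C 3) :=
  [set P * Y | P in ideal_I eps].

Lemma left_ideal_DIY eps : left_ideal (ideal_DIY eps).
Proof.
have [I0 ID IM] := left_ideal_genP
  [set Delta1 eps + Delta3 eps; Delta2 eps + Delta3 eps; Hop eps].
split=> [|_ _ [P IP <-] [Q IQ <-]|P _ [Q IQ <-]].
- by exists 0; rewrite ?mul0r.
- by exists (P + Q); [exact: ID|rewrite mulrDl].
- by exists (P * Q); [exact: IM|rewrite mulrA].
Qed.

Definition rat_extension (J : set (weyl_poly C 3)) : set (weyl_rat C 3) :=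
  left_ideal_gen (@to_rat C 3 @` J).

End TwoSiteChain.

(* Main.v *)
Require Import Defs.
From HB Require Import structures.
From mathcomp Require Import all_boot all_order all_algebra.
From mathcomp Require Import mpoly complex ring.
From mathcomp Require Import boolp classical_sets functions reals.

(* Write theta_k = c_k d_k.  Modulo the Euler operators, theta_1, theta_4,
   theta_2, theta_6 act as theta_5 - eps, -theta_5 - 1, theta_7 - eps,
   -theta_7 - 1.  Hence the restriction ideal contains
     A_k = d_k (theta_k - eps) + d_3 (theta_k + 1)   (k = 5, 7),
     E = theta_3 + theta_5 + theta_7 + 1 - 2 eps,
   and after the change of variables H Y = Y E and
     Delta_j + Delta_3 = ((X_j + Y) d_{X_j} - eps) E - 2 Y A_k
   with (j, k) = (1, 5), (2, 7), which gives the inclusion.  Conversely A_5, A_7, E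
   generate the restriction: C[c]<d> acts on power series in c_1 - 1, c_2 - 1,
   c_4 - 1, c_6 - 1 with coefficients in C[c_3,c_5,c_7]<d_3,d_5,d_7>, and the
   series whose Taylor coefficients are products of falling factorials of the
   four operators above is killed by the GKZ system modulo A_5, A_7, E.
   Evaluating at c_1 = c_2 = c_4 = c_6 = 1 then puts every element of the
   restriction in the ideal (A_5, A_7, E).  Since Y becomes invertible in the
   rational Weyl algebra, both ideals extend to the same one. *)

Local Open Scope classical_set_scope.
Local Open Scope ring_scope.

Import GRing.Theory.

Set Implicit Arguments.
Unset Strict Implicit.
Unset Printing Implicit Defensive.

(** * The ring of additive endomorphisms of an abelian group *)

Section Endomorphisms.
Variable V : zmodType.

Record endo := Endo { endo_fun :> V -> V; endoB : zmod_morphism endo_fun }.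

HB.instance Definition _ (a : endo) :=
  GRing.isZmodMorphism.Build V V (endo_fun a) (endoB a).

HB.instance Definition _ := gen_eqMixin endo.
HB.instance Definition _ := gen_choiceMixin endo.

Lemma endoP (a b : endo) : a =1 b -> a = b.
Proof.
case: a b => [f fB] [g gB] /= /funext fg.
by case: g / fg gB => gB; congr Endo; exact: Prop_irrelevance.
Qed.

Program Definition endo_zero := @Endo (fun=> 0) _.
Next Obligation. by move=> u v; rewrite subr0. Qed.
Program Definition endo_one := @Endo id _.
Next Obligation. by []. Qed.
Program Definition endo_add (a b : endo) := @Endo (fun v => a v + b v) _.
Next Obligation. by move=> u v; rewrite !raddfB opprD addrACA. Qed.
Program Definition endo_opp (a : endo) := @Endo (fun v => - a v) _.
Next Obligation. by move=> u v; rewrite raddfB opprD. Qed.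
Program Definition endo_mul (a b : endo) := @Endo (fun v => a (b v)) _.
Next Obligation. by move=> u v; rewrite !raddfB. Qed.

Local Lemma endo_addA : associative endo_add.
Proof. by move=> a b c; apply: endoP => v; exact: addrA. Qed.
Local Lemma endo_addC : commutative endo_add.
Proof. by move=> a b; apply: endoP => v; exact: addrC. Qed.
Local Lemma endo_add0 : left_id endo_zero endo_add.
Proof. by move=> a; apply: endoP => v; exact: add0r. Qed.
Local Lemma endo_addN : left_inverse endo_zero endo_opp endo_add.
Proof. by move=> a; apply: endoP => v; exact: addNr. Qed.

HB.instance Definition _ :=
  GRing.isZmodule.Build endo endo_addA endo_addC endo_add0 endo_addN.

Local Lemma endo_mulA : associative endo_mul.
Proof. by move=> a b c; apply: endoP. Qed.
Local Lemma endo_mul1l : left_id endo_one endo_mul.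
Proof. by move=> a; apply: endoP. Qed.
Local Lemma endo_mul1r : right_id endo_one endo_mul.
Proof. by move=> a; apply: endoP. Qed.
Local Lemma endo_mulDl : left_distributive endo_mul endo_add.
Proof. by move=> a b c; apply: endoP. Qed.
Local Lemma endo_mulDr : right_distributive endo_mul endo_add.
Proof. by move=> a b c; apply: endoP => v; exact: raddfD. Qed.

HB.instance Definition _ := GRing.Zmodule_isPzRing.Build endo
  endo_mulA endo_mul1l endo_mul1r endo_mulDl endo_mulDr.

End Endomorphisms.

(** * Induction on generators of the polynomial Weyl algebra *)

Section WeylPoly.
Variables (C : fieldType) (n : nat).

(** Coefficients are sums of scalar multiples of products of variables, and an opposite is a product
    by the scalar -1, so neither needs a case of its own. *)
Lemma weyl_poly_ind (Q : weyl_poly C n -> Prop) :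
  (forall c, Q (wscal n c)) -> (forall i, Q (wvar C i)) ->
  (forall i, Q (wpartial C i)) ->
  (forall P P', Q P -> Q P' -> Q (P + P')) ->
  (forall P P', Q P -> Q P' -> Q (P * P')) -> forall P, Q P.
Proof.
move=> Qc Qx Qd QD QM.
have Q1 : Q 1 by rewrite -(rmorph1 (@wpoly C n)) -mpolyC1; exact: Qc.
have Qp p : Q (wpoly p).
  elim/mpolyind: p => [|c m p _ _ Qp]; first by rewrite -mpolyC0; exact: Qc.
  rewrite rmorphD -mul_mpolyC rmorphM; apply: (QD) => //; apply: (QM).
    exact: Qc.
  rewrite mpolyXE_id rmorph_prod; apply: (big_ind Q) => [//| |i _]; first exact: QM.
  rewrite rmorphXn /=; elim: (m i) => [//|k Qk].
  by rewrite exprS; apply: (QM) => //; exact: Qx.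
apply: wpiW; elim=> [p|i|s Qs t Qt|s Qs|s Qs t Qt] //.
- exact: Qp.
- exact: Qd.
- by rewrite -wpiD; exact: QD.
- rewrite -wpiN.
  have -> : weyl_opp (wpi (@mpolyC n C) (fun i => 'X_i) s)
     = wscal n (-1) * (wpi _ _ s : weyl_poly C n).
    by rewrite /wscal mpolyCN rmorphN mpolyC1 rmorph1 mulN1r.
  exact: QM.
- by rewrite -wpiM; exact: QM.
Qed.

End WeylPoly.

(** * Representations of the Weyl algebra in a noncommutative ring *)

Section WeylPolyRepresentation.
Variables (C : fieldType) (n : nat) (S : pzRingType).
Variables (f : {rmorphism C -> S}) (h e : 'I_n -> S).

Definition wrep_spec : Prop :=
  [/\ forall i j, GRing.comm (h i) (h j), forall i c, GRing.comm (h i) (f c),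
      forall i j, GRing.comm (e i) (e j), forall i c, GRing.comm (e i) (f c)
    & forall i j, e i * h j = h j * e i + (i == j)%:R].

Hypothesis fhe : wrep_spec.

Definition mon_eval (m : 'X_{1..n}) : S := \prod_(i < n) h i ^+ m i.

(* Multinomials' [mmap] is a ring morphism only for images of the variables
   that are central in a nontrivial ring. *)
Definition comm_eval of wrep_spec := fun p : {mpoly C[n]} =>
  \sum_(m <- msupp p) f p@_m * mon_eval m.

Lemma mon_evalD m k : mon_eval (m + k) = mon_eval m * mon_eval k.
Proof.
have [hC _ _ _ _] := fhe; rewrite /mon_eval -prodrM_comm.
  by apply: eq_bigr => i _; rewrite mnmDE exprD.
by move=> i j _ _; apply: commrX; apply: commr_sym; exact: commrX.
Qed.

Lemma mon_eval_comm m c : GRing.comm (mon_eval m) (f c).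
Proof.
have [_ hf _ _ _] := fhe; apply: commr_sym; apply: commr_prod => i _.
by apply: commrX; exact: commr_sym.
Qed.

(** Additivity needs one list of monomials shared by several polynomials. *)
Lemma comm_eval_sub (p : {mpoly C[n]}) s : uniq s -> {subset msupp p <= s} ->
  comm_eval fhe p = \sum_(m <- s) f p@_m * mon_eval m.
Proof.
move=> Us sps; rewrite (bigID (fun m => m \in msupp p)) /= [X in _ + X]big1 ?addr0.
  rewrite -big_filter; apply: perm_big; apply: uniq_perm => //.
    by rewrite filter_uniq.
  by move=> m; rewrite mem_filter; case: (boolP (m \in _)) => // /sps ->.
by move=> m /memN_msupp_eq0 ->; rewrite rmorph0 mul0r.
Qed.

Local Lemma comm_eval_zmod_morphism : zmod_morphism (comm_eval fhe).
Proof.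
move=> p q; pose s := undup (msupp (p - q) ++ msupp p ++ msupp q).
have Us : uniq s by exact: undup_uniq.
rewrite !(comm_eval_sub Us) -?sumrB.
- by apply: eq_bigr => m _; rewrite mcoeffB rmorphB mulrBl.
- by move=> m mq; rewrite mem_undup !mem_cat mq !orbT.
- by move=> m mp; rewrite mem_undup !mem_cat mp !orbT.
- by move=> m mpq; rewrite mem_undup !mem_cat mpq.
Qed.

HB.instance Definition _ := GRing.isZmodMorphism.Build
  {mpoly C[n]} S (comm_eval fhe) comm_eval_zmod_morphism.

Lemma comm_evalZX c m : comm_eval fhe (c *: 'X_[m]) = f c * mon_eval m.
Proof.
rewrite (@comm_eval_sub _ [:: m]) //; last first.
  by move=> k /msuppZ_le; rewrite msuppX.
by rewrite big_seq1 mcoeffZ mcoeffX eqxx mulr1.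
Qed.

Local Lemma comm_eval_monoid_morphism : monoid_morphism (comm_eval fhe).
Proof.
have one1 : mon_eval 0 = 1.
  by apply: big1 => i _; rewrite mnm0E expr0.
split=> [|p q].
  by rewrite -[1]scale1r -mpolyX0 comm_evalZX rmorph1 mul1r one1.
rewrite {1}(mpolyE p) {1}(mpolyE q) mulr_suml raddf_sum [RHS]mulr_suml.
apply: eq_bigr => m _; rewrite mulr_sumr raddf_sum mulr_sumr.
apply: eq_bigr => k _; rewrite -scalerAl -scalerAr scalerA -mpolyXD.
rewrite /= comm_evalZX mon_evalD rmorphM -!mulrA; congr (_ * _).
by rewrite [RHS]mulrA mon_eval_comm mulrA.
Qed.

HB.instance Definition _ := GRing.isMonoidMorphism.Build
  {mpoly C[n]} S (comm_eval fhe) comm_eval_monoid_morphism.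

Lemma comm_evalC c : comm_eval fhe c%:MP = f c.
Proof.
rewrite -[c%:MP]mulr1 mul_mpolyC -mpolyX0 comm_evalZX /mon_eval big1 ?mulr1 //.
by move=> i _; rewrite mnm0E expr0.
Qed.

Lemma comm_evalX i : comm_eval fhe 'X_i = h i.
Proof.
rewrite -[X in comm_eval _ X]scale1r comm_evalZX rmorph1 mul1r /mon_eval.
rewrite (big_only1 i) ?mnm1E ?eqxx // => j ji _.
by rewrite mnm1E eq_sym (negPf ji).
Qed.

Lemma wrep_lift_spec :
  wlift_spec (@mpolyC n C) (fun i => 'X_i) (comm_eval fhe) e.
Proof.
have [_ _ eC ef ex] := fhe.
by split=> [i j|i c|i j]; rewrite /= ?(comm_evalC, comm_evalX);
  [exact: eC|exact: ef|].
Qed.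

Definition wrep : weyl_poly C n -> S := wlift (comm_eval fhe) e.

HB.instance Definition _ := GRing.isZmodMorphism.Build
  (weyl_poly C n) S wrep (wlift_zmod_morphism wrep_lift_spec).
HB.instance Definition _ := GRing.isMonoidMorphism.Build
  (weyl_poly C n) S wrep (wlift_monoid_morphism wrep_lift_spec).

Lemma wrep_scal c : wrep (wscal n c) = f c.
Proof. by rewrite /wrep (wlift_coef wrep_lift_spec) /= comm_evalC. Qed.

Lemma wrep_var i : wrep (wvar C i) = h i.
Proof. by rewrite /wrep (wlift_coef wrep_lift_spec) /= comm_evalX. Qed.

Lemma wrep_partial i : wrep (wpartial C i) = e i.
Proof. by rewrite /wrep (wlift_der wrep_lift_spec). Qed.

End WeylPolyRepresentation.

(** * Falling factorials in a noncommutative ring *)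

Section FallingFactorial.
Variable A : pzRingType.
Implicit Types a t s d : A.

Definition ffact t k : A := \prod_(i < k) (t - i%:R).

Lemma ffactSr t k : ffact t k.+1 = ffact t k * (t - k%:R).
Proof. exact: big_ord_recr. Qed.

Lemma ffactSl t k : ffact t k.+1 = t * ffact (t - 1) k.
Proof.
rewrite /ffact big_ord_recl subr0; congr (_ * _); apply: eq_bigr => i _.
by rewrite -addrA -opprD -natr1 [1 + _]addrC.
Qed.

(** Serves with [s = t] for commutation and with [s] a shift of [t] for derivations, which shift
    their own Euler operator. *)
Lemma ffact_intertwine a t s k : a * t = s * a -> a * ffact t k = ffact s k * a.
Proof.
move=> ats; elim: k => [|k IHk]; first by rewrite /ffact !big_ord0 mulr1 mul1r.
rewrite !ffactSr mulrA IHk -!mulrA; congr (_ * _).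
by rewrite mulrBr mulrBl ats (commr_nat a k).
Qed.

Lemma comm_ffact a t k : GRing.comm a t -> GRing.comm a (ffact t k).
Proof. exact: ffact_intertwine. Qed.

End FallingFactorial.

(* A function [phi] on multi-indices stands for the power series
   \sum_m phi(m) s^m / m!; [shift i] is the derivation d/ds_i and [spread i] is
   the multiplication by s_i. *)
Section TaylorCoefficients.
Variables (A : pzRingType) (n : nat).
Local Notation V := ('X_{1..n} -> A).
Implicit Types (phi : V) (m : 'X_{1..n}) (i j : 'I_n).

Program Definition shift i : endo V := @Endo V (fun phi m => phi (m + U_(i))%MM) _.
Next Obligation. by []. Qed.

(** The factor [m i] comes from the 1/m! in the series; it also kills the term with [m i = 0], where
    the subtraction of [U_(i)] is truncated. *)
Program Definition spread i : endo V :=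
  @Endo V (fun phi m => phi (m - U_(i))%MM *+ m i) _.
Next Obligation. by move=> phi psi; apply/funext => m; exact: mulrnBl. Qed.

Program Definition pointwise (a : A) : endo V := @Endo V (fun phi m => a * phi m) _.
Next Obligation. by move=> phi psi; apply/funext => m; exact: mulrBr. Qed.

Local Lemma pointwise_zmod_morphism : zmod_morphism pointwise.
Proof.
by move=> a b; apply: endoP => phi; apply/funext => m; exact: mulrBl.
Qed.

Local Lemma pointwise_monoid_morphism : monoid_morphism pointwise.
Proof.
split=> [|a b]; apply: endoP => phi; apply/funext => m; first exact: mul1r.
by rewrite /= mulrA.
Qed.

HB.instance Definition _ :=
  GRing.isZmodMorphism.Build A (endo V) pointwise pointwise_zmod_morphism.
HB.instance Definition _ :=
  GRing.isMonoidMorphism.Build A (endo V) pointwise pointwise_monoid_morphism.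

Lemma shiftC i j : GRing.comm (shift i) (shift j).
Proof.
by apply: endoP => phi; apply/funext => m /=; rewrite -!addmA [(U_(i) + _)%MM]addmC.
Qed.

Lemma spreadC i j : GRing.comm (spread i) (spread j).
Proof.
apply: endoP => phi; apply/funext => m /=; rewrite -!mulrnA.
have -> : (m - U_(i) - U_(j) = m - U_(j) - U_(i))%MM.
  by apply/mnmP => k; rewrite !mnmBE subnAC.
case: (eqVneq i j) => [-> //|ij].
by rewrite !mnmBE !mnm1E [j == i]eq_sym (negPf ij) !subn0 mulnC.
Qed.

Lemma shift_spread i j : shift i * spread j = spread j * shift i + (i == j)%:R.
Proof.
apply: endoP => phi; apply/funext => m.
have E : ((i == j)%:R : endo V) phi m = phi m *+ (i == j) by case: eqP.
rewrite -[RHS]/(spread j (shift i phi) m + ((i == j)%:R : endo V) phi m) {}E.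
rewrite /= mnmDE mnm1E.
have [<-|ij] := eqVneq i j.
  rewrite addmK addn1 mulrSr; congr (_ + _).
  case: (posnP (m i)) => [->|mi]; first by rewrite !mulr0n.
  by rewrite submK // lep1mP -lt0n.
rewrite addn0 mulr0n addr0; case: (posnP (m j)) => [->|mj].
  by rewrite !mulr0n.
congr (phi _ *+ _); apply/mnmP => k; rewrite !(mnmBE, mnmDE, mnm1E).
case: (eqVneq j k) => [<-|_]; last by rewrite !subn0.
by rewrite (negPf ij) !addn0.
Qed.

Lemma pointwise_shift a i : GRing.comm (pointwise a) (shift i).
Proof. by apply: endoP. Qed.

Lemma pointwise_spread a i : GRing.comm (pointwise a) (spread i).
Proof.
by apply: endoP => phi; apply/funext => m; rewrite /= mulrnAr.
Qed.

End TaylorCoefficients.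

(** * Binomial series with operator exponents *)

Section FallingFactorialSeries.
Variables (A : pzRingType) (n : nat).
Implicit Types (T : 'I_n -> A) (m : 'X_{1..n}) (i j : 'I_n).

(** For commuting exponents these are the Taylor coefficients of the product of the binomial series
    (1 + s_i)^(T i). *)
Definition ffseries T : 'X_{1..n} -> A := fun m => \prod_(i < n) ffact (T i) (m i).

Lemma ffseries_intertwine a T T' m : (forall i, a * T i = T' i * a) ->
  a * ffseries T m = ffseries T' m * a.
Proof.
move=> aT; rewrite /ffseries; elim: (index_enum _) => [|i s IHs].
  by rewrite !big_nil mulr1 mul1r.
by rewrite !big_cons mulrA (ffact_intertwine _ (aT i)) -!mulrA IHs.
Qed.

Section Commuting.
Variable T : 'I_n -> A.
Hypothesis TC : forall i j, GRing.comm (T i) (T j).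

Let lower j : 'I_n -> A := fun i => T i - (i == j)%:R.

Local Lemma lowerC i j k : GRing.comm (lower k i) (T j).
Proof.
by apply: commr_sym; apply: commrB; [exact: TC|exact: commr_nat].
Qed.

(** The derivative of (1 + s_j)^t is t (1 + s_j)^(t - 1); on coefficients this is [ffactSl]. *)
Lemma ffseries_shift j m : ffseries T (m + U_(j))%MM = ffseries (lower j) m * T j.
Proof.
(* Writing [T j] as a product over all indices lets the two products merge factor by factor. *)
pose G i := if i == j then T i else 1.
have <- : \prod_(i < n) G i = T j.
  by rewrite (big_only1 j) /G ?eqxx // => i /negPf -> _.
rewrite /ffseries -prodrM_comm => [|i k _ _].
  apply: eq_bigr => i _; rewrite mnmDE mnm1E /G /lower eq_sym.
  case: eqP => [->|_]; last by rewrite addn0 subr0 mulr1.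
  rewrite addn1 ffactSl; apply: comm_ffact.
  by apply: commrB; [exact: TC|exact: commr1].
rewrite /G; case: eqP => [->|_]; last exact: commr1.
by apply: commr_sym; apply: comm_ffact; apply: commr_sym; exact: lowerC.
Qed.

(** The operator (1 + s_j) d/ds_j multiplies (1 + s_j)^t by t. On coefficients, the shift gives the
    factor [T j - (m j)%:R] by [ffactSr], and the term from [spread] restores [m j]. *)
Lemma ffseries_euler j m :
  ((1 + spread A j) * shift A j) (ffseries T) m = T j * ffseries T m.
Proof.
have -> : ((1 + spread A j) * shift A j) (ffseries T) m =
    ffseries T (m + U_(j))%MM + ffseries T (m - U_(j) + U_(j))%MM *+ m j by [].
have -> : ffseries T (m - U_(j) + U_(j))%MM *+ m j = ffseries T m *+ m j.
  case: (posnP (m j)) => [->|mj]; first by rewrite !mulr0n.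
  by rewrite submK // lep1mP -lt0n.
suff -> : ffseries T (m + U_(j))%MM = (T j - (m j)%:R) * ffseries T m.
  by rewrite mulrBl mulr_natl subrK.
pose G i := if i == j then T i - (m i)%:R else 1.
have <- : \prod_(i < n) G i = T j - (m j)%:R.
  by rewrite (big_only1 j) /G ?eqxx // => i /negPf -> _.
rewrite /ffseries -prodrM_comm => [|i k _ _].
  apply: eq_bigr => i _; rewrite mnmDE mnm1E /G eq_sym.
  case: eqP => [->|_]; last by rewrite addn0 mul1r.
  rewrite addn1 ffactSr; apply: commr_sym; apply: comm_ffact; apply: commr_sym.
  by apply: commrB; [exact: TC|exact: commr_nat].
rewrite /G; case: eqP => [->|_]; last by apply: commr_sym; exact: commr1.
apply: comm_ffact; apply: commr_sym; apply: commrB; [exact: TC|exact: commr_nat].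
Qed.

(** Each shift lowers one exponent. Moving [d] across the series trades the lowering at [i] for the
    one at [j], so both terms share a left factor. *)
Lemma ffseries_toric d d' i j m :
    (forall k, d * T k = (T k + (k == i)%:R - (k == j)%:R) * d) ->
    (forall k, GRing.comm d' (T k)) ->
  d * ffseries T (m + U_(i))%MM - d' * ffseries T (m + U_(j))%MM =
    ffseries (lower j) m * (d * T i - d' * T j).
Proof.
move=> dT d'T; rewrite !ffseries_shift mulrBr !mulrA; congr (_ * _ - _ * _).
  apply: ffseries_intertwine => k; rewrite /lower mulrBr dT.
  rewrite (commr_nat d (k == i)) -mulrBl; congr (_ * _).
  by rewrite -!addrA; congr (_ + _); rewrite addrCA subrr addr0.
apply: ffseries_intertwine => k; rewrite /lower mulrBr mulrBl.
by rewrite (d'T k) (commr_nat d').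
Qed.

End Commuting.
End FallingFactorialSeries.

Local Open Scope complex_scope.

(** * Commutation rules for variables, derivations and Euler operators *)

Section WeylCommutation.
Variables (C : fieldType) (n : nat).
Implicit Types (i j : 'I_n) (P : weyl_poly C n).

Lemma comm_wscal c P : GRing.comm P (wscal n c).
Proof. exact: wscalC. Qed.

Lemma wvar_comm i j : GRing.comm (wvar C i) (wvar C j).
Proof. exact: wpolyC. Qed.

Lemma wpartial_var_neq i j : i != j -> GRing.comm (wpartial C i) (wvar C j).
Proof. by move=> ij; rewrite /GRing.comm wpartial_var (negPf ij) addr0. Qed.

Definition wtheta i : weyl_poly C n := wvar C i * wpartial C i.

Lemma wpartial_theta i : wpartial C i * wtheta i = (wtheta i + 1) * wpartial C i.
Proof. by rewrite {1}/wtheta mulrA wpartial_var eqxx. Qed.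

Lemma wpartial_theta_neq i j : i != j -> GRing.comm (wpartial C i) (wtheta j).
Proof.
by move=> ij; apply: commrM; [exact: wpartial_var_neq|exact: wpartialC].
Qed.

Lemma wtheta_comm i j : GRing.comm (wtheta i) (wtheta j).
Proof.
have [->//|ij] := eqVneq i j.
apply: commr_sym; apply: commrM; apply: commr_sym; last first.
  exact: wpartial_theta_neq.
apply: commrM; first exact: wvar_comm.
by apply: commr_sym; apply: wpartial_var_neq; rewrite eq_sym.
Qed.

End WeylCommutation.

(** * Values of the inclusion on generators *)

Section Inclusion.
Variable R : realType.
Local Notation C := R[i].
Local Notation D3 := (weyl_poly C 3).

Lemma incl357_scal a : incl357 (wscal 3 a : D3) = wscal 7 a.
Proof. by rewrite /incl357 (wlift_coef (incl357_spec R)) /= comp_mpolyC. Qed.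

Lemma incl357_var i : incl357 (wvar C i) = wvar C (tnth sel357 i).
Proof.
rewrite /incl357 (wlift_coef (incl357_spec R)) /= comp_mpolyXU -tnth_nth.
by rewrite tnth_mktuple.
Qed.

Lemma incl357_partial i : incl357 (wpartial C i) = wpartial C (tnth sel357 i).
Proof. exact: wlift_der (incl357_spec R) i. Qed.

End Inclusion.

(** * Upper bound for the restriction, by the action on Taylor coefficients *)

Section Restriction.
Variables (R : realType) (eps : R).
Local Notation C := R[i].
Local Notation D3 := (weyl_poly C 3).
Local Notation D7 := (weyl_poly C 7).
Local Notation ord n k := (@Ordinal n k.-1 isT).
Local Notation z k := (wvar C (ord 3 k)).
Local Notation dz k := (wpartial C (ord 3 k)).
Local Notation th k := (wtheta C (ord 3 k)).
Local Notation e := (wscal 3 (eps%:C : C)).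

(* In c_3, c_5, c_7 (numbered 1, 2, 3), the toric operators with the
   derivations in c_1, c_2, c_4, c_6 eliminated by the Euler operators. *)
Definition toric_res (k : 'I_3) : D3 :=
  wpartial C k * (wtheta C k - e) + dz 1 * (wtheta C k + 1).

(** The third Euler operator, with theta_1 and theta_2 replaced by theta_5 - eps and theta_7 -
    eps. *)
Definition euler_res : D3 := (th 2 - e) + (th 3 - e) + th 1 + 1.

Definition res_gens : set D3 :=
  [set toric_res (ord 3 2); toric_res (ord 3 3); euler_res].

(** Kept variables go left. The restricted ones go right in the order c_1, c_4, c_2, c_6, which
    pairs those that meet in the same toric operator. *)
Definition position (k : 'I_7) : 'I_3 + 'I_4 :=
  nth (inl ord0) [:: inr (ord 4 1); inr (ord 4 3); inl (ord 3 1);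
    inr (ord 4 2); inl (ord 3 2); inr (ord 4 4); inl (ord 3 3)] k.

Local Notation V := ('X_{1..4} -> D3).

(** A restricted variable is c_k = 1 + s_j, where s_j is its deviation from the point of
    restriction. *)
Definition taylor_var (k : 'I_7) : endo V :=
  match position k with
  | inl i => pointwise 4 (wvar C i)
  | inr j => 1 + spread D3 j
  end.

Definition taylor_der (k : 'I_7) : endo V :=
  match position k with
  | inl i => pointwise 4 (wpartial C i)
  | inr j => shift D3 j
  end.

Lemma position_eq k l : (k == l) = (position k == position l).
Proof.
by rewrite /position nth_uniq.
Qed.

Lemma pointwise_comm a b : GRing.comm a b ->
  GRing.comm (pointwise 4 a : endo V) (pointwise 4 b).
Proof. by move=> ab; rewrite /GRing.comm -!rmorphM ab. Qed.

Lemma taylor_spec : wrep_spec (pointwise 4 \o (@wpoly C 3 \o @mpolyC 3 C))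
  taylor_var taylor_der.
Proof.
split=> [k l|k c|k l|k c|k l]; rewrite /taylor_var /taylor_der ?position_eq.
- case: (position k) => i; case: (position l) => j.
  + by apply: pointwise_comm; exact: wvar_comm.
  + by apply: commrD; [exact: commr1|exact: pointwise_spread].
  + apply: commr_sym; apply: commrD; [exact: commr1|exact: pointwise_spread].
  + apply: commrD; [exact: commr1|apply: commr_sym].
    by apply: commrD; [exact: commr1|exact: spreadC].
- case: (position k) => i /=; first by apply: pointwise_comm; exact: comm_wscal.
  by apply: commr_sym; apply: commrD; [exact: commr1|exact: pointwise_spread].
- case: (position k) => i; case: (position l) => j.
  + by apply: pointwise_comm; exact: wpartialC.
  + exact: pointwise_shift.
  + by apply: commr_sym; exact: pointwise_shift.
  + exact: shiftC.
- case: (position k) => i /=; first by apply: pointwise_comm; exact: comm_wscal.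
  by apply: commr_sym; exact: pointwise_shift.
- case: (position k) => i; case: (position l) => j.
  + by rewrite -!rmorphM wpartial_var rmorphD rmorph_nat.
  + rewrite addr0; apply: commrD; [exact: commr1|exact: pointwise_spread].
  + by rewrite addr0; apply: commr_sym; exact: pointwise_shift.
  + by rewrite mulrDr mulrDl mulr1 mul1r shift_spread addrA.
Qed.

(* The action on Taylor coefficients at c_1 = c_2 = c_4 = c_6 = 1. *)
Definition taylor_act : D7 -> endo V := wrep taylor_spec.

HB.instance Definition _ := GRing.RMorphism.copy taylor_act (wrep taylor_spec).

Lemma taylor_act_var k : taylor_act (wvar C k) = taylor_var k.
Proof. exact: wrep_var. Qed.

Lemma taylor_act_partial k : taylor_act (wpartial C k) = taylor_der k.
Proof. exact: wrep_partial. Qed.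

Lemma taylor_act_incl (P : D3) : taylor_act (incl357 P) = pointwise 4 P.
Proof.
elim/weyl_poly_ind: P => [c|i|i|P Q|P Q].
- by rewrite incl357_scal; exact: wrep_scal.
- rewrite incl357_var taylor_act_var /taylor_var.
  by case: i => -[|[|[|//]]] i3; congr pointwise; congr wvar; apply: val_inj.
- rewrite incl357_partial taylor_act_partial /taylor_der.
  by case: i => -[|[|[|//]]] i3; congr pointwise; congr wpartial; apply: val_inj.
- by move=> EP EQ; rewrite !rmorphD /= EP EQ.
- by move=> EP EQ; rewrite !rmorphM /= EP EQ.
Qed.

Local Notation J := (left_ideal_gen res_gens).

(* Modulo the Euler operators and at c_1 = c_2 = c_4 = c_6 = 1, these are
   theta_1, theta_4, theta_2 and theta_6. *)
Definition euler_weight (j : 'I_4) : D3 :=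
  nth 0 [:: th 2 - e; - th 2 - 1; th 3 - e; - th 3 - 1] j.

Local Notation T := euler_weight.

Lemma comm_euler_weight (a : D3) j : GRing.comm a (th 2) -> GRing.comm a (th 3) ->
  GRing.comm a (T j).
Proof.
move=> a2 a3; have a1 := commr1 a; have ae := comm_wscal (eps%:C : C) a.
rewrite /T; case: j => -[|[|[|[|//]]]] ?; rewrite /=;
  by apply: commrB => //; exact: commrN.
Qed.

Lemma euler_weightC i j : GRing.comm (T i) (T j).
Proof.
by apply: comm_euler_weight; apply: commr_sym; apply: comm_euler_weight;
  exact: wtheta_comm.
Qed.

Lemma euler_res_comm k : GRing.comm euler_res (wtheta C k).
Proof.
have t2 := wtheta_comm C k (ord 3 2); have t3 := wtheta_comm C k (ord 3 3).
have te := comm_wscal (eps%:C : C) (wtheta C k).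
apply: commr_sym; apply: commrD; last exact: commr1.
by apply: commrD; [apply: commrD; exact: commrB|exact: wtheta_comm].
Qed.

(* The vector satisfying the GKZ system modulo the pointwise action of J. *)
Definition gkz_vector : V := ffseries T.

Lemma taylor_actD a b phi m :
  taylor_act (a + b) phi m = taylor_act a phi m + taylor_act b phi m.
Proof. by rewrite rmorphD. Qed.

Lemma taylor_actN a phi m : taylor_act (- a) phi m = - taylor_act a phi m.
Proof. by rewrite rmorphN. Qed.

Lemma taylor_actM a b phi :
  taylor_act (a * b) phi = taylor_act a (taylor_act b phi).
Proof. by rewrite rmorphM. Qed.

Lemma taylor_act1 phi m : taylor_act 1 phi m = phi m.
Proof. by rewrite rmorph1. Qed.

Lemma taylor_act_scal c phi m : taylor_act (wscal 7 c) phi m = wscal 3 c * phi m.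
Proof. by rewrite /taylor_act wrep_scal. Qed.

Lemma taylor_act_theta k m : taylor_act (wvar C k * wpartial C k) gkz_vector m =
  match position k with inl i => wtheta C i | inr j => T j end * gkz_vector m.
Proof.
rewrite taylor_actM taylor_act_var taylor_act_partial /taylor_var /taylor_der.
case: (position k) => i; first by rewrite /= mulrA.
exact: ffseries_euler euler_weightC _ _.
Qed.

Lemma res_ideal : left_ideal J. Proof. exact: left_ideal_genP. Qed.

(** The action thus descends to series with coefficients in the quotient by [J]. *)
Lemma taylor_act_stable q phi : (forall m, J (phi m)) ->
  forall m, J (taylor_act q phi m).
Proof.
have [J0 JD JM] := res_ideal.
elim/weyl_poly_ind: q phi => [c|k|k|P Q EP EQ|P Q EP EQ] phi Jphi m.
- by rewrite taylor_act_scal; exact: JM.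
- rewrite taylor_act_var /taylor_var; case: (position k) => j; first exact: JM.
  apply: JD; first exact: Jphi.
  by rewrite /= -mulr_natl; apply: JM; exact: Jphi.
- rewrite taylor_act_partial /taylor_der; case: (position k) => j; first exact: JM.
  exact: Jphi.
- by rewrite taylor_actD; apply: JD; [exact: EP|exact: EQ].
- by rewrite taylor_actM; apply: EP; exact: EQ.
Qed.

(** Since d_k raises theta_k by 1, it raises [T i], lowers [T j] and fixes the other weights, as
    [ffseries_toric] requires. The right factor left over is [toric_res k]. *)
Lemma gkz_vector_toric (k : 'I_3) (i j : 'I_4) m :
    i != j -> res_gens (toric_res k) ->
    T i = wtheta C k - e -> T j = - wtheta C k - 1 ->
    (forall l, l != i -> l != j -> GRing.comm (wpartial C k) (T l)) ->
  J (wpartial C k * gkz_vector (m + U_(i))%MM - dz 1 * gkz_vector (m + U_(j))%MM).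
Proof.
move=> ij gen_k Ti Tj Tl; have [_ _ JM] := res_ideal.
have d1 l : GRing.comm (dz 1) (T l).
  by apply: comm_euler_weight; exact: wpartial_theta_neq.
rewrite (ffseries_toric euler_weightC m _ d1); last first.
  move=> l; have [->|li] := eqVneq l i.
    rewrite (negPf ij) subr0 Ti mulrBr wpartial_theta comm_wscal -mulrBl.
    by rewrite addrAC.
  have [->|lj] := eqVneq l j.
    rewrite addr0 Tj mulrBr mulrN wpartial_theta mulr1 !mulrBl mulNr mul1r.
    by rewrite mulrDl mul1r opprD.
  by rewrite addr0 subr0; exact: Tl.
apply: JM; rewrite Ti Tj -opprD mulrN opprK.
exact: sub_left_ideal_gen.
Qed.

(** The operators that send the vector into [J] form a left ideal by [taylor_act_stable], so the
    generators suffice. *)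
Lemma gkz_ideal_act h m : gkz_ideal eps h -> J (taylor_act h gkz_vector m).
Proof.
have [J0 JD JM] := res_ideal.
pose vanish : set D7 := [set h | forall m, J (taylor_act h gkz_vector m)].
have vanish_ideal : left_ideal vanish.
  split=> [k|P Q vP vQ k|P Q vQ k].
  - by rewrite rmorph0; exact: J0.
  - by rewrite taylor_actD; apply: JD; [exact: vP|exact: vQ].
  - by rewrite taylor_actM; apply: taylor_act_stable; exact: vQ.
have toric : @toric_ideal R `<=` vanish.
  apply: smallest_sub => // _ [->|->] k; rewrite taylor_actD taylor_actN !taylor_actM.
    rewrite !taylor_act_partial.
    apply: (@gkz_vector_toric (ord 3 3) (ord 4 3) (ord 4 4)) => //.
      by left; right.
    case=> -[|[|[|[|//]]]] l4 // _ _; rewrite /T /=.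
      apply: commrB; last exact: comm_wscal.
      exact: wpartial_theta_neq.
    apply: commrB; last exact: commr1.
    by apply: commrN; exact: wpartial_theta_neq.
  rewrite !taylor_act_partial.
  apply: (@gkz_vector_toric (ord 3 2) (ord 4 1) (ord 4 2)) => //.
    by left; left.
  case=> -[|[|[|[|//]]]] l4 // _ _; rewrite /T /=.
    apply: commrB; last exact: comm_wscal.
    exact: wpartial_theta_neq.
  apply: commrB; last exact: commr1.
  by apply: commrN; exact: wpartial_theta_neq.
have euler : euler_ideal eps `<=` vanish.
  (* The weights make four of the five Euler operators kill the vector outright; only the third
     leaves something, namely [euler_res]. *)
  have zero a : (a - e) + (- a - 1) + (e + 1) = 0.
    by rewrite [a - e + _]addrACA subrr add0r -opprD addNr.
  apply: smallest_sub => // _ [[[[->|->]|->]|->]|->] k;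
    rewrite !taylor_actD ?taylor_act1 ?taylor_act_theta ?taylor_act_scal;
    rewrite /position /T /=.
  - by rewrite -[X in _ + (_ + X)]mul1r -!mulrDl zero mul0r; exact: J0.
  - by rewrite -[X in _ + (_ + X)]mul1r -!mulrDl zero mul0r; exact: J0.
  - rewrite -[X in _ + X]mul1r -!mulrDl.
    rewrite [X in X * _](_ : _ = euler_res) //.
    (* Here [euler_res] multiplies from the left, while the left ideal [J] absorbs it only on the
       right. *)
    have comm_e : GRing.comm euler_res (gkz_vector k).
      by apply: ffseries_intertwine => j; apply: comm_euler_weight;
        exact: euler_res_comm.
    by rewrite comm_e; apply: JM; apply: sub_left_ideal_gen; right.
  - rewrite -[X in _ + X]mul1r -!mulrDl -addrA -opprD addNr mul0r; exact: J0.
  - rewrite -[X in _ + X]mul1r -!mulrDl -addrA -opprD addNr mul0r; exact: J0.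
case=> P tP [Q eQ <-]; rewrite taylor_actD.
by apply: JD; [exact: toric|exact: euler].
Qed.

(** Constant terms are compared: the vector has constant term 1, so [P] gives [P] itself, while a
    multiple of c_k - 1 = s_j gives 0. *)
Lemma gkz_restriction_sub : gkz_restriction eps `<=` J.
Proof.
have restr q k j : position k = inr j ->
    taylor_act ((wvar C k - 1) * q) gkz_vector 0%MM = 0.
  move=> kj; rewrite taylor_actM taylor_actD taylor_actN taylor_act1.
  rewrite taylor_act_var /taylor_var kj.
  set phi := taylor_act _ _.
  have -> : (1 + spread D3 j) phi 0%MM = phi 0%MM + phi (0 - U_(j))%MM *+ 0%MM j.
    by [].
  by rewrite mnm0E mulr0n addr0 subrr.
move=> P [h Hh [q1 [q2 [q4 [q6 EP]]]]].
have := congr1 (fun Q => taylor_act Q gkz_vector 0%MM) EP.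
rewrite taylor_act_incl !taylor_actD.
rewrite (restr _ _ (ord 4 1)) // (restr _ _ (ord 4 3)) //.
rewrite (restr _ _ (ord 4 2)) // (restr _ _ (ord 4 4)) // !addr0 /=.
have -> : gkz_vector 0%MM = 1.
  by apply: big1 => i _; rewrite mnm0E /ffact big_ord0.
by rewrite mulr1 => ->; exact: gkz_ideal_act.
Qed.

End Restriction.

(** * Elimination of the restricted derivations *)

Section ToricReduction.
Variables (A : pzRingType) (cp cr dp dr dk dt thk e : A).
Let thp := cp * dp.
Let thr := cr * dr.
Let Ep := thp + thr + (e + 1).
Let Er := thr + thk + 1.

Lemma euler_diff : Ep - Er = thp - (thk - e).
Proof.
rewrite /Ep /Er !opprD opprK !addrA.
by rewrite [LHS](ACl ((1*6*3)*(2*5)*(4*7))) /= !subrr !addr0.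
Qed.

(** Read with (p, r, k, t) = (1, 4, 5, 3) or (2, 6, 7, 3). Multiplied by c_p c_r, the toric operator
    becomes c_r d_k theta_p - c_p d_t theta_r. The Euler operators turn theta_p into theta_k - e and
    theta_r into -theta_k - 1, and the last two terms remove the prefactors c_r and c_p. *)
Lemma toric_reduction : GRing.comm cp cr -> GRing.comm cp dk -> GRing.comm cp dt ->
    GRing.comm cr dt -> GRing.comm dk dp ->
  dk * (thk - e) + dt * (thk + 1) =
    cp * cr * (dp * dk - dt * dr) + (- (cr * dk) * (Ep - Er) + cp * dt * Er)
    + (cp - 1) * (- (dt * (thk + 1))) + (cr - 1) * (- (dk * (thk - e))).
Proof.
move=> cpr cpdk cpdt crdt dkp.
have -> : cp * cr * (dp * dk - dt * dr) = cr * dk * thp - cp * dt * thr.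
  rewrite mulrBr; congr (_ - _); rewrite /thp /thr.
    by rewrite cpr -dkp !mulrA -[_ * dk * cp]mulrA -cpdk !mulrA.
  by rewrite !mulrA -[_ * dt * cr]mulrA -crdt !mulrA.
rewrite mulNr; have -> : cr * dk * (Ep - Er) = cr * dk * thp - cr * (dk * (thk - e)).
  by rewrite euler_diff [LHS]mulrBr !mulrA.
have -> : cp * dt * Er = cp * dt * thr + cp * (dt * (thk + 1)).
  by rewrite /Er -addrA [LHS]mulrDr !mulrA.
move: (dk * (thk - e)) (dt * (thk + 1)) (cr * dk * thp) (cp * dt * thr).
move=> X Y u w; rewrite !mulrN !mulrBl !mul1r !opprB !addrA.
by rewrite [RHS](ACl ((9*7)*(1*4)*(5*2)*(3*10)*(6*8))) /= !subrr !addr0.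
Qed.

(* Stated apart because rewriting with [mulr0] is very slow in a Weyl algebra,
   whose operations get unfolded by failed unifications. *)
Lemma add_mul0_24 (h a b c d x y : A) :
  h + a * x + b * 0 + c * y + d * 0 = h + a * x + c * y.
Proof. by rewrite !mulr0 !addr0. Qed.

Lemma add_mul0_13 (h a b c d x y : A) :
  h + a * 0 + b * x + c * 0 + d * y = h + b * x + d * y.
Proof. by rewrite !mulr0 !addr0. Qed.

Lemma euler_reduction (V : zmodType) (t1 t2 t3 a1 a2 c : V) :
  t1 + t2 + t3 + c - (t1 - a1) - (t2 - a2) = a1 + a2 + t3 + c.
Proof.
rewrite !opprB !addrA.
by rewrite [LHS](ACl ((5*7*3*4)*(1*6)*(2*8))) /= !subrr !addr0.
Qed.

End ToricReduction.

(** * Left ideals under sums, morphisms and right multiplication *)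

Section IdealLemmas.
Variables A B : pzRingType.

Lemma ideal_sum_ideal (I J : set A) :
  left_ideal I -> left_ideal J -> left_ideal (ideal_sum I J).
Proof.
move=> [I0 ID IM] [J0 JD JM]; split.
- by exists 0 => //; exists 0 => //; rewrite addr0.
- move=> _ _ [P IP [Q JQ <-]] [P' IP' [Q' JQ' <-]].
  exists (P + P'); first exact: ID.
  by exists (Q + Q'); [exact: JD|rewrite addrACA].
- move=> a _ [P IP [Q JQ <-]]; exists (a * P); first exact: IM.
  by exists (a * Q); [exact: JM|rewrite mulrDr].
Qed.

Lemma preimage_ideal (f : {rmorphism A -> B}) (I : set B) :
  left_ideal I -> left_ideal (f @^-1` I).
Proof.
move=> [I0 ID IM]; split; rewrite /preimage /=.
- by rewrite rmorph0.
- by move=> P Q IP IQ; rewrite rmorphD; exact: ID.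
- by move=> P Q IQ; rewrite rmorphM; exact: IM.
Qed.

Lemma image_ideal (f : {rmorphism A -> B}) (I : set A) :
  (forall b, exists a, f a = b) -> left_ideal I -> left_ideal (f @` I).
Proof.
move=> f_surj [I0 ID IM]; split.
- by exists 0; rewrite ?rmorph0.
- by move=> _ _ [P IP <-] [Q IQ <-]; exists (P + Q); [exact: ID|rewrite rmorphD].
- move=> b _ [Q IQ <-]; have [a <-] := f_surj b.
  by exists (a * Q); [exact: IM|rewrite rmorphM].
Qed.

Lemma right_mul_ideal (I : set A) (y : A) :
  left_ideal I -> left_ideal [set P | I (P * y)].
Proof.
move=> [I0 ID IM]; split=> /= [|P Q IP IQ|P Q IQ].
- by rewrite mul0r.
- by rewrite mulrDl; exact: ID.
- by rewrite -mulrA; exact: IM.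
Qed.

Lemma ideal_opp (I : set A) P : left_ideal I -> I P -> I (- P).
Proof. by move=> [_ _ IM] IP; rewrite -mulN1r; exact: IM. Qed.

End IdealLemmas.

(** * The three generators belong to the restriction *)

Section Membership.
Variables (R : realType) (eps : R).
Local Notation C := R[i].
Local Notation D3 := (weyl_poly C 3).
Local Notation D7 := (weyl_poly C 7).
Local Notation ord n k := (@Ordinal n k.-1 isT).
Local Notation c k := (wvar C (ord 7 k)).
Local Notation dc k := (wpartial C (ord 7 k)).
Local Notation th k := (wtheta C (ord 7 k)).
Local Notation e := (wscal 7 (eps%:C : C)).

Lemma incl357_comm k (P : D3) : k \notin sel357 ->
  GRing.comm (wvar C k) (incl357 P).
Proof.
move=> k357; elim/weyl_poly_ind: P => [a|i|i|P Q cP cQ|P Q cP cQ].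
- by rewrite incl357_scal; exact: comm_wscal.
- by rewrite incl357_var; exact: wvar_comm.
- rewrite incl357_partial; apply: commr_sym; apply: wpartial_var_neq.
  by apply: contraNneq k357 => <-; exact: mem_tnth.
- by rewrite rmorphD; exact: commrD.
- by rewrite rmorphM; exact: commrM.
Qed.

Lemma gkz_ideal_ideal : left_ideal (gkz_ideal eps).
Proof. by apply: ideal_sum_ideal; exact: left_ideal_genP. Qed.

(** The terms (c_k - 1) q are right multiples, yet they survive left multiplication: included
    operators commute with the restricted variables. *)
Lemma gkz_restriction_ideal : left_ideal (gkz_restriction eps).
Proof.
have [H0 HD HM] := gkz_ideal_ideal; split.
- exists 0 => //; exists 0, 0, 0, 0.
  by rewrite rmorph0 !mulr0 !addr0.
- move=> P Q [h Hh [p1 [p2 [p4 [p6 EP]]]]] [h' Hh' [q1 [q2 [q4 [q6 EQ]]]]].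
  exists (h + h'); first exact: HD.
  exists (p1 + q1), (p2 + q2), (p4 + q4), (p6 + q6).
  rewrite rmorphD /= EP EQ !mulrDr.
  by rewrite [LHS]addrACA; congr (_ + _); rewrite [LHS]addrACA; congr (_ + _);
    rewrite [LHS]addrACA; congr (_ + _); exact: addrACA.
- move=> P Q [h Hh [q1 [q2 [q4 [q6 EQ]]]]].
  exists (incl357 P * h); first exact: HM.
  exists (incl357 P * q1), (incl357 P * q2), (incl357 P * q4), (incl357 P * q6).
  have cP k : k \notin sel357 ->
      forall q, incl357 P * ((wvar C k - 1) * q) = (wvar C k - 1) * (incl357 P * q).
    move=> k357 q; rewrite !mulrA; congr (_ * _).
    by rewrite mulrBr mulrBl mulr1 mul1r incl357_comm.
  by rewrite rmorphM /= EQ !mulrDr !cP.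
Qed.

Lemma gkz_restriction_gens : res_gens eps `<=` gkz_restriction eps.
Proof.
have [H0 HD HM] := gkz_ideal_ideal.
have [E0 ED EM] : left_ideal (euler_ideal eps) by exact: left_ideal_genP.
have [T0 TD TM] : left_ideal (@toric_ideal R) by exact: left_ideal_genP.
have E1 : euler_ideal eps (th 1 + th 4 + (e + 1)).
  by apply: sub_left_ideal_gen; do 4 left.
have E2 : euler_ideal eps (th 2 + th 6 + (e + 1)).
  by apply: sub_left_ideal_gen; do 3 left; right.
have E3 : euler_ideal eps (th 1 + th 2 + th 3 + 1).
  by apply: sub_left_ideal_gen; do 2 left; right.
have E4 : euler_ideal eps (th 4 + th 5 + 1).
  by apply: sub_left_ideal_gen; left; right.
have E5 : euler_ideal eps (th 6 + th 7 + 1).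
  by apply: sub_left_ideal_gen; right.
have T7 : @toric_ideal R (dc 2 * dc 7 - dc 3 * dc 6).
  by apply: sub_left_ideal_gen; left.
have T5 : @toric_ideal R (dc 1 * dc 5 - dc 3 * dc 4).
  by apply: sub_left_ideal_gen; right.
have incl_toric k : incl357 (toric_res eps k) =
    wpartial C (tnth sel357 k) * (wtheta C (tnth sel357 k) - e)
    + dc 3 * (wtheta C (tnth sel357 k) + 1).
  rewrite /toric_res /wtheta !(rmorphD, rmorphM, rmorphN, rmorph1).
  by rewrite /= !incl357_var !incl357_partial incl357_scal.
have EN P : euler_ideal eps P -> euler_ideal eps (- P).
  by apply: ideal_opp.
have cd k l : k != l -> GRing.comm (wvar C k) (wpartial C l).
  by move=> kl; apply: commr_sym; apply: wpartial_var_neq; rewrite eq_sym.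
move=> _ [[->|->]|->].
- pose h := c 1 * c 4 * (dc 1 * dc 5 - dc 3 * dc 4) +
    (- (c 4 * dc 5) * (th 1 + th 4 + (e + 1) - (th 4 + th 5 + 1))
     + c 1 * dc 3 * (th 4 + th 5 + 1)).
  exists h.
    exists (c 1 * c 4 * (dc 1 * dc 5 - dc 3 * dc 4)); first exact: TM.
    eexists; last reflexivity.
    by apply: (ED); apply: (EM) => //; apply: (ED) => //; exact: EN.
  exists (- (dc 3 * (th 5 + 1))), 0, (- (dc 5 * (th 5 - e))), 0.
  apply: etrans (incl_toric _) _; apply: etrans (esym (add_mul0_24 _ _ _ _ _ _ _)).
  by apply: toric_reduction; [exact: wvar_comm|exact: cd..|exact: wpartialC].
- pose h := c 2 * c 6 * (dc 2 * dc 7 - dc 3 * dc 6) +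
    (- (c 6 * dc 7) * (th 2 + th 6 + (e + 1) - (th 6 + th 7 + 1))
     + c 2 * dc 3 * (th 6 + th 7 + 1)).
  exists h.
    exists (c 2 * c 6 * (dc 2 * dc 7 - dc 3 * dc 6)); first exact: TM.
    eexists; last reflexivity.
    by apply: (ED); apply: (EM) => //; apply: (ED) => //; exact: EN.
  exists 0, (- (dc 3 * (th 7 + 1))), 0, (- (dc 7 * (th 7 - e))).
  apply: etrans (incl_toric _) _; apply: etrans (esym (add_mul0_13 _ _ _ _ _ _ _)).
  by apply: toric_reduction; [exact: wvar_comm|exact: cd..|exact: wpartialC].
(* This generator already lies in the Euler ideal, as a combination of all five Euler operators. *)
- exists (incl357 (euler_res eps)); last first.
    by exists 0, 0, 0, 0; rewrite !mulr0 !addr0.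
  exists 0 => //; exists (incl357 (euler_res eps)); last exact: add0r.
  have -> : incl357 (euler_res eps) = th 1 + th 2 + th 3 + 1
      - (th 1 + th 4 + (e + 1) - (th 4 + th 5 + 1))
      - (th 2 + th 6 + (e + 1) - (th 6 + th 7 + 1)).
    rewrite !euler_diff euler_reduction /euler_res /wtheta.
    rewrite !(rmorphD, rmorphM, rmorphN, rmorph1).
    by rewrite /= !incl357_var !incl357_partial incl357_scal.
  by apply: (ED); [apply: (ED) => //|]; apply: (EN); apply: (ED) => //; exact: EN.
Qed.

End Membership.

(** * The operator identity relating the Delta operators to the toric ones *)

Section DeltaIdentity.
Variables (K : comNzRingType) (A : pzRingType) (f : {rmorphism K -> A}).
Variables (xi xj y e : K) (di dj dy D : A).

(** Normal form with coefficients on the left, so that equalities reduce to [ring] in [K]. It has no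
    slot for [dy], which occurs only inside [Euler]. *)
Let nf (p : K * K * K * K * K) : A :=
  let: (p2, p11, pj, pi, p0) := p in
  f p2 * (dj * dj) + f p11 * (dj * di) + f pj * dj + f pi * di + f p0.

Local Lemma nfD p2 p11 pj pi p0 q2 q11 qj qi q0 :
  nf (p2, p11, pj, pi, p0) + nf (q2, q11, qj, qi, q0) =
  nf (p2 + q2, p11 + q11, pj + qj, pi + qi, p0 + q0).
Proof.
rewrite /nf !rmorphD !mulrDl.
by do 4 (rewrite [LHS]addrACA; congr (_ + _)).
Qed.

Local Lemma nfN p2 p11 pj pi p0 :
  - nf (p2, p11, pj, pi, p0) = nf (- p2, - p11, - pj, - pi, - p0).
Proof. by rewrite /nf !rmorphN !mulNr !opprD. Qed.

Local Notation u := (xj + y).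
Local Notation v := (xi + y).
Local Notation Euler := (f xi * di + f xj * dj + f y * dy + 1 - f (e + e)).
Local Notation Q := (f u * dj - f e).

Hypothesis jj : dj * f xj = f xj * dj + 1.
Hypothesis ji : GRing.comm dj (f xi).
Hypothesis jy : GRing.comm dj (f y).
Hypothesis De : GRing.comm D (f e).
Hypothesis D2 : D + D = dj + dy - di.

Local Lemma fcomm a b : GRing.comm (f a) (f b).
Proof. by rewrite /GRing.comm -!rmorphM mulrC. Qed.

Hypothesis je : GRing.comm dj (f e).

Local Lemma doubled_D : f y * (D + D) =
  f (y - xj) * dj - f v * di + f (e + e - 1) + Euler.
Proof.
rewrite D2 mulrBr mulrDr [f (y - xj)]rmorphB [f v]rmorphD [f (_ - 1)]rmorphB.
rewrite rmorph1 mulrBl mulrDl opprD !addrA.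
rewrite [RHS](ACl ((1*9*4)*(8*2)*(7*3)*(5*11)*(10*6))) /=.
by rewrite !subrr !addr0.
Qed.

Local Lemma Q_lead : Q * (f (y - xj) * dj) =
  nf (u * (y - xj), 0, - (u + e * (y - xj)), 0, 0).
Proof.
have jb : dj * f (y - xj) = f (y - xj) * dj - 1.
  by rewrite rmorphB mulrBr jy jj mulrBl opprD addrA.
rewrite [LHS]mulrBl -[f u * dj * _]mulrA [dj * (_ * _)]mulrA jb.
rewrite mulrBl mul1r [f u * _]mulrBr !mulrA.
rewrite /nf rmorph0 !mul0r !addr0 rmorphN [f (_ + e * _)]rmorphD !rmorphM.
by rewrite mulNr mulrDl opprD !mulrA addrA.
Qed.

Local Lemma Q_mixed : Q * (f v * di) = nf (0, u * v, 0, - (e * v), 0).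
Proof.
have jv : dj * f v = f v * dj by rewrite rmorphD mulrDr ji jy mulrDl.
rewrite [LHS]mulrBl -[f u * dj * _]mulrA [dj * (_ * _)]mulrA jv.
by rewrite /nf rmorph0 !mul0r !addr0 add0r rmorphN !rmorphM mulNr !mulrA.
Qed.

Local Lemma Q_const a : GRing.comm dj (f a) ->
  Q * f a = nf (0, 0, u * a, 0, - (e * a)).
Proof.
move=> ja; rewrite [LHS]mulrBl -[f u * dj * _]mulrA ja.
by rewrite /nf rmorph0 !mul0r !addr0 !add0r rmorphN !rmorphM !mulrA.
Qed.

(** The left side is Delta_j + Delta_3. On the right, the bracket equals [Q * D + dj]; multiplied by
    2y and rewritten by [doubled_D], it produces [Q * Euler], which cancels, and an operator free of
    [dy]. *)
Lemma delta_identity :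
  nf (xj ^+ 2 - y ^+ 2, u * v, (1 + 1) * (1 - e) * xj - e * u, - (e * v),
      e ^+ 2 - e * (1 - e)) =
  Q * Euler
  - f (y + y) * (D * (f u * D - f e) + (dj - D) * (f u * D + 1)).
Proof.
have ju : dj * f u = f u * dj + 1.
  by rewrite rmorphD mulrDr jy jj mulrDl addrAC.
set L := f (y - xj) * dj - f v * di + f (e + e - 1).
have EZ : f y * (D + D) = L + Euler := doubled_D.
have -> : f (y + y) * (D * (f u * D - f e) + (dj - D) * (f u * D + 1)) =
    Q * (f y * (D + D)) + f (y + y) * dj.
  (* The terms [D * f u * D] cancel, and the commutator of [dj] with [f u] cancels the remaining
     [- D]. *)
  have -> : D * (f u * D - f e) + (dj - D) * (f u * D + 1) =
      Q * D + dj.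
    rewrite mulrBr De mulrBl !mulrDr !mulr1 [dj * (f u * D)]mulrA ju.
    rewrite [(_ + 1) * D]mulrDl mul1r [Q * D]mulrBl opprD !addrA.
    by rewrite [LHS](ACl ((3*2*5)*(1*6)*(4*7))) /= !subrr !addr0.
  have yQ : GRing.comm (f y) Q.
    apply: commrB; last exact: fcomm.
    by apply: commrM; [exact: fcomm|exact: commr_sym].
  rewrite [LHS]mulrDr; congr (_ + _).
  by rewrite rmorphD mulrDl mulrDr mulrDr !mulrA yQ.
rewrite EZ [Q * (L + _)]mulrDr.
have QL : Q * L = nf (u * (y - xj), - (u * v),
    - (u + e * (y - xj)) + u * (e + e - 1), e * v, - (e * (e + e - 1))).
  rewrite /L !mulrDr mulrN Q_lead Q_mixed Q_const; last first.
    rewrite rmorphB rmorphD rmorph1.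
    by apply: commrB; [exact: commrD|exact: commr1].
  by rewrite nfN !nfD; congr nf; do 4 (congr pair; last by ring); ring.
have y2 : f (y + y) * dj = nf (0, 0, y + y, 0, 0).
  by rewrite /nf rmorph0 !mul0r !addr0 !add0r.
rewrite QL y2 [nf _ + _ + _]addrAC nfD opprD addrCA subrr addr0 nfN.
by congr nf; do 4 (congr pair; last by ring); ring.
Qed.

End DeltaIdentity.

(** * Images of the generators in the coordinates X_1, X_2, Y *)

Section ChangeOfVariables.
Variables (R : realType) (eps : R).
Local Notation C := R[i].
Local Notation D3 := (weyl_poly C 3).
Local Notation ord n k := (@Ordinal n k.-1 isT).
Local Notation X1 := (wvar C (ord 3 1)).
Local Notation X2 := (wvar C (ord 3 2)).
Local Notation Y := (wvar C (ord 3 3)).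
Local Notation dX1 := (wpartial C (ord 3 1)).
Local Notation dX2 := (wpartial C (ord 3 2)).
Local Notation dY := (wpartial C (ord 3 3)).
Local Notation e := (wscal 3 (eps%:C : C)).
Local Notation Q xj dj := ((xj + Y) * dj - e).

Lemma cov_scal a : cov (wscal 3 a : D3) = wscal 3 a.
Proof. by rewrite /cov (wlift_coef (cov_spec R)) /= /cov_coef comp_mpolyC. Qed.

Lemma cov_var i : cov (wvar C i : D3) = nth 0 [:: X1 + X2; X1 + Y; X2 + Y] i.
Proof.
rewrite /cov (wlift_coef (cov_spec R)) /= /cov_coef comp_mpolyXU.
by case: i => -[|[|[|//]]] i3 /=; rewrite -rmorphD.
Qed.

Lemma cov_partial i : cov (wpartial C i : D3) = cov_der R i.
Proof. exact: wlift_der (cov_spec R) i. Qed.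

(** Surjectivity makes the image of a left ideal a left ideal. *)
Lemma cov_surj (P : D3) : exists P', cov P' = P.
Proof.
elim/weyl_poly_ind: P => [a|i|i|_ _ [P <-] [P' <-]|_ _ [P <-] [P' <-]].
- by exists (wscal 3 a); exact: cov_scal.
- have half3 (a b c : D3) : wscal 3 (2^-1 : C) * (a + b + (a + c) - (b + c)) = a.
    rewrite -[RHS]Defs.half_double; congr (_ * _).
    by rewrite addrACA addrK.
  case: i => -[|[|[|//]]] i3.
  (* In the witnesses [X1], [X2], [Y] stand for c_3, c_5, c_7; this one is X_1 = (c_3 + c_5 -
     c_7)/2. *)
  + exists (wscal 3 (2^-1 : C) * (X1 + X2 - Y)).
    rewrite rmorphM rmorphB rmorphD /= cov_scal !cov_var /=.
    by rewrite half3; congr wvar; apply: val_inj.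
  + exists (wscal 3 (2^-1 : C) * (X1 + Y - X2)).
    rewrite rmorphM rmorphB rmorphD /= cov_scal !cov_var /=.
    by rewrite [X1 + X2]addrC half3; congr wvar; apply: val_inj.
  + exists (wscal 3 (2^-1 : C) * (X2 + Y - X1)).
    rewrite rmorphM rmorphB rmorphD /= cov_scal !cov_var /=.
    rewrite [X1 + Y]addrC [X2 + Y]addrC half3.
    by congr wvar; apply: val_inj.
- case: i => -[|[|[|//]]] i3.
  + exists (dX1 + dX2); rewrite cov_dX1; congr wpartial; exact: val_inj.
  + exists (dX1 + dY); rewrite cov_dX2; congr wpartial; exact: val_inj.
  + exists (dX2 + dY); rewrite cov_dY; congr wpartial; exact: val_inj.
- by exists (P + P'); rewrite rmorphD.
- by exists (P * P'); rewrite rmorphM.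
Qed.

(** The Euler vector field is invariant under linear changes of variables. *)
Lemma cov_euler : cov (euler_res eps) = Hop eps + 1.
Proof.
rewrite /Hop /euler_res /wtheta !(rmorphD, rmorphM, rmorphN, rmorph1) /=.
rewrite !cov_var cov_scal /=.
move: (cov_dX1 R) (cov_dX2 R) (cov_dY R); rewrite !rmorphD /=.
move: (cov dX1) (cov dX2) (cov dY) => d3 d5 d7 <- <- <-.
rewrite mulr_natl mulr2n !(mulrDl, mulrDr) opprD !addrA.
by rewrite [LHS](ACl (7*1*8*4*2*5*3*6*9)).
Qed.

(** Passing [Y] to the left raises its Euler operator by 1, which supplies the constant in
    [cov_euler]. *)
Lemma Hop_euler : Hop eps * Y = Y * cov (euler_res eps).
Proof.
have thY i : i != ord 3 3 -> wtheta C i * Y = Y * wtheta C i.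
  move=> iY; apply: commr_sym; apply: commrM; first exact: wvar_comm.
  by apply: commr_sym; exact: wpartial_var_neq.
have thYY : wtheta C (ord 3 3) * Y = Y * (wtheta C (ord 3 3) + 1).
  by rewrite {1}/wtheta -mulrA wpartial_var eqxx.
have eY : (2%:R * e) * Y = Y * (2%:R * e).
  by apply: commr_sym; apply: commrM; [exact: commr_nat|exact: comm_wscal].
rewrite cov_euler /Hop mulrBl [in LHS]mulrDl [in LHS]mulrDl.
by rewrite eY thYY !thY // -!mulrDr -mulrBr addrA [_ + 1 - _]addrAC.
Qed.

(** Treats both cases at once: c_k becomes X_j + Y, and X_i is the other site variable. *)
Let delta_id i j k (y := ord 3 3) (D := cov (wpartial C k) : D3) :
  i != j -> i != y -> j != y ->
  cov (wpartial C (ord 3 1) : D3) = wpartial C j - D ->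
  D = wscal 3 (2^-1 : C) * (wpartial C j + dY - wpartial C i) ->
  cov (wvar C k : D3) = wvar C j + Y ->
  Hop eps = wvar C i * wpartial C i + wvar C j * wpartial C j + Y * dY - 2%:R * e ->
  (wvar C j ^+ 2 - Y ^+ 2) * wpartial C j ^+ 2
  + 2%:R * (1 - e) * wvar C j * wpartial C j - e * (1 - e)
  + ((wvar C j + Y) * (wvar C i + Y) * wpartial C j * wpartial C i
     - e * (wvar C j + Y) * wpartial C j - e * (wvar C i + Y) * wpartial C i
     + e ^+ 2)
  = Q (wvar C j) (wpartial C j) * cov (euler_res eps)
    - (Y + Y) * cov (toric_res eps k).
Proof.
move=> ij iy jy d3 DE xk HE.
have D2 : D + D = wpartial C j + dY - wpartial C i.
  by rewrite DE -mulrDr; exact: Defs.half_double.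
have -> : cov (toric_res eps k) = D * ((wvar C j + Y) * D - e)
     + (wpartial C j - D) * ((wvar C j + Y) * D + 1).
  rewrite /toric_res /wtheta !(rmorphD, rmorphM, rmorphN, rmorph1) /=.
  by rewrite d3 xk cov_scal.
rewrite cov_euler HE.
have jj : wpartial C j * wvar C j = wvar C j * wpartial C j + 1.
  by rewrite wpartial_var eqxx.
have ji : GRing.comm (wpartial C j) (wvar C i).
  by apply: wpartial_var_neq; rewrite eq_sym.
have := @delta_identity _ _ (@wpoly C 3) 'X_i 'X_j 'X_y (eps%:C)%:MP
  (wpartial C i) (wpartial C j) dY D jj ji
  (wpartial_var_neq _ jy) (comm_wscal _ _) D2 (comm_wscal _ _).
rewrite /= !rmorphB !rmorphD !rmorphN !rmorphM !rmorphB !rmorphD ?rmorph1 /= => E.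
rewrite [_ - 2%:R * e + 1]addrAC [2%:R * e in RHS]mulr_natl mulr2n.
apply: etrans E; rewrite !expr2 [(_ - e * _) * _]mulrBl mulNr !mulrA !addrA.
by rewrite [LHS](ACl (1*4*2*5*6*7*3)).
Qed.

Lemma cov_toric1 : Delta1 eps + Delta3 eps =
  Q X1 dX1 * cov (euler_res eps) - (Y + Y) * cov (toric_res eps (ord 3 2)).
Proof.
have d3 : cov (wpartial C (ord 3 1) : D3) = dX1 - cov (wpartial C (ord 3 2)).
  by apply/eqP; rewrite eq_sym subr_eq -rmorphD; apply/eqP/esym/cov_dX1.
have D5 : cov (wpartial C (ord 3 2) : D3) = wscal 3 (2^-1 : C) * (dX1 + dY - dX2).
  by rewrite cov_partial /cov_der (tnth_nth 0).
have HE : Hop eps = X2 * dX2 + X1 * dX1 + Y * dY - 2%:R * e.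
  by rewrite /Hop [X1 * _ + _]addrC.
exact: (@delta_id (ord 3 2) (ord 3 1) (ord 3 2) _ _ _ d3 D5 (cov_var _) HE).
Qed.

Lemma cov_toric2 : Delta2 eps + Delta3 eps =
  Q X2 dX2 * cov (euler_res eps) - (Y + Y) * cov (toric_res eps (ord 3 3)).
Proof.
have d3 : cov (wpartial C (ord 3 1) : D3) = dX2 - cov (wpartial C (ord 3 3)).
  by apply/eqP; rewrite eq_sym subr_eq -rmorphD; apply/eqP/esym/cov_dX2.
have D7 : cov (wpartial C (ord 3 3) : D3) = wscal 3 (2^-1 : C) * (dX2 + dY - dX1).
  by rewrite cov_partial /cov_der (tnth_nth 0).
rewrite -(@delta_id (ord 3 1) (ord 3 2) (ord 3 3)
  _ _ _ d3 D7 (cov_var _) (erefl _)) //.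
congr (_ + (_ + _)); rewrite [LHS]addrAC; congr (_ - _ - _).
have X12 : (X1 + Y) * (X2 + Y) = (X2 + Y) * (X1 + Y) by rewrite -!rmorphD wpolyC.
by rewrite X12 -!mulrA; do 2 congr (_ * _); exact: wpartialC.
Qed.

(** None of these operators involves the derivation in Y. *)
Lemma Delta_comm P :
  P \in [:: Delta1 eps; Delta2 eps; Delta3 eps] -> GRing.comm P Y.
Proof.
have c1 : GRing.comm Y dX1 by apply: commr_sym; exact: wpartial_var_neq.
have c2 : GRing.comm Y dX2 by apply: commr_sym; exact: wpartial_var_neq.
have cx i : GRing.comm Y (wvar C i) by exact: wvar_comm.
have ce : GRing.comm Y e by exact: comm_wscal.
have c1e : GRing.comm Y (1 - e) := commrB (commr1 Y) ce.
have cD j d : GRing.comm Y d -> GRing.comm Y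
    ((wvar C j ^+ 2 - Y ^+ 2) * d ^+ 2 + 2%:R * (1 - e) * wvar C j * d - e * (1 - e)).
  move=> cd; apply: commrB (commrM ce c1e).
  apply: commrD (commrM (commrM (commrM (commr_nat Y 2) c1e) (cx j)) cd).
  exact: commrM (commrB (commrX 2 (cx j)) (commrX 2 (cx _))) (commrX 2 cd).
have cxY j : GRing.comm Y (wvar C j + Y) := commrD (cx j) (cx _).
rewrite !inE => /or3P[]/eqP->; apply: commr_sym; [exact: cD|exact: cD|].
apply: commrD (commrX 2 ce); apply: commrB (commrM (commrM ce (cxY _)) c2).
apply: commrB (commrM (commrM ce (cxY _)) c1).
exact: commrM (commrM (commrM (cxY _) (cxY _)) c1) c2.
Qed.

End ChangeOfVariables.

(** * Comparison of the two ideals *)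

Section Conclusion.
Variables (R : realType) (eps : R).
Local Notation C := R[i].
Local Notation D3 := (weyl_poly C 3).
Local Notation ord n k := (@Ordinal n k.-1 isT).
Local Notation Y := (wvar C (ord 3 3)).

Lemma gkz_res_ideal : left_ideal (gkz_res eps).
Proof.
by apply: image_ideal; [exact: cov_surj|exact: gkz_restriction_ideal].
Qed.

Lemma gkz_res_gens g : res_gens eps g -> gkz_res eps (cov g).
Proof. by move=> gg; exists g => //; exact: gkz_restriction_gens. Qed.

Lemma DIY_sub_gkz_res : ideal_DIY eps `<=` gkz_res eps.
Proof.
have [H0 HD HM] := gkz_res_ideal.
have E : gkz_res eps (cov (euler_res eps)) by apply: gkz_res_gens; right.
have T1 : gkz_res eps (cov (toric_res eps (ord 3 2))).
  by apply: gkz_res_gens; left; left.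
have T2 : gkz_res eps (cov (toric_res eps (ord 3 3))).
  by apply: gkz_res_gens; left; right.
move=> _ [P IP <-]; move: P IP.
(* The [P] with [P * Y] in the restricted system form a left ideal, so three generators suffice. *)
apply: smallest_sub; first exact: right_mul_ideal gkz_res_ideal.
have D1 := @Delta_comm _ eps (Delta1 eps).
have D2 := @Delta_comm _ eps (Delta2 eps).
have D3 := @Delta_comm _ eps (Delta3 eps).
move=> _ [[->|->]|->] /=; last by rewrite Hop_euler; exact: HM.
  rewrite mulrDl D1 ?D3 ?inE ?eqxx ?orbT // -mulrDr cov_toric1.
  by apply: (HM); apply: (HD); [|apply: (ideal_opp gkz_res_ideal)]; exact: HM.
rewrite mulrDl D2 ?D3 ?inE ?eqxx ?orbT // -mulrDr cov_toric2.
by apply: (HM); apply: (HD); [|apply: (ideal_opp gkz_res_ideal)]; exact: HM.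
Qed.

(** A nonzero polynomial is invertible in the rational Weyl algebra. *)
Lemma rat_ideal_cancel (X : set (weyl_rat C 3)) p (P : D3) : left_ideal X ->
  p != 0 -> X (to_rat (wpoly p * P)) -> X (to_rat P).
Proof.
move=> [_ _ XM] p0 XpP.
have -> : to_rat P = wcoef _ _ (tofrac p)^-1 * to_rat (wpoly p * P).
  rewrite rmorphM mulrA /= {2}/to_rat (wlift_coef (@to_rat_spec C 3)) /=.
  by rewrite -rmorphM mulVf ?tofrac_eq0 // rmorph1 mul1r.
exact: XM.
Qed.

Lemma mpolyX_mulrn_neq0 (i : 'I_3) k : ('X_i *+ k.+1 : {mpoly C[3]}) != 0.
Proof.
apply/eqP => /(congr1 (mcoeff U_(i))).
by rewrite mcoeffMn mcoeffX eqxx mcoeff0 => /eqP; rewrite Num.Theory.pnatr_eq0.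
Qed.

Lemma rat_extension_eq :
  rat_extension (ideal_DIY eps) = rat_extension (gkz_res eps).
Proof.
have gen_ideal J := left_ideal_genP (@to_rat C 3 @` J).
apply/seteqP; split.
  apply: smallest_sub; first exact: gen_ideal.
  by move=> _ [P DP <-]; apply: sub_left_ideal_gen; exists P => //;
    exact: DIY_sub_gkz_res.
set X := rat_extension (ideal_DIY eps).
have X_ideal : left_ideal X by exact: gen_ideal.
have [X0 XD XM] := X_ideal.
have XIY P : ideal_I eps P -> X (to_rat (P * Y)).
  by move=> IP; apply: sub_left_ideal_gen; exists (P * Y) => //; exists P.
have XE : X (to_rat (cov (euler_res eps))).
  apply: (rat_ideal_cancel (p := 'X_(ord 3 3)) X_ideal).
    exact: (mpolyX_mulrn_neq0 _ 0).
  by rewrite -[_ * _]Hop_euler; apply: XIY; apply: sub_left_ideal_gen; right.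
(* The identity is solved for [(Y + Y) * cov (toric_res eps k)]. Cancelling [Y] puts [P] in the
   extension, and cancelling [Y + Y] isolates the toric generator. *)
have XT P S k : GRing.comm P Y -> ideal_I eps P ->
    P = S * cov (euler_res eps) - (Y + Y) * cov (toric_res eps k) ->
    X (to_rat (cov (toric_res eps k))).
  move=> PY IP EP.
  apply: (rat_ideal_cancel (p := 'X_(ord 3 3) + 'X_(ord 3 3)) X_ideal).
    exact: (mpolyX_mulrn_neq0 _ 1).
  have -> : wpoly ('X_(ord 3 3) + 'X_(ord 3 3)) * cov (toric_res eps k) =
      S * cov (euler_res eps) - P by rewrite EP rmorphD opprB [RHS]addrC subrK.
  rewrite rmorphB; apply: XD; first by rewrite rmorphM; exact: XM.
  apply: (ideal_opp X_ideal).
  apply: (rat_ideal_cancel (p := 'X_(ord 3 3)) X_ideal).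
    exact: (mpolyX_mulrn_neq0 _ 0).
  by rewrite -[_ * _]PY; exact: XIY.
apply: smallest_sub => // _ [_ [P rP <-] <-].
(* The pullback of [X] along both morphisms is a left ideal; once it contains [res_gens], it
   contains the restriction by [gkz_restriction_sub]. *)
have pre := preimage_ideal (@cov R) (preimage_ideal (@to_rat C 3) X_ideal).
suff sub : left_ideal_gen (res_gens eps) `<=` @cov R @^-1` (@to_rat C 3 @^-1` X).
  exact: sub (gkz_restriction_sub rP).
apply: smallest_sub => // _ [[->|->]|->] //.
- apply: XT (cov_toric1 eps).
    by apply: commr_sym; apply: commrD; apply: commr_sym;
      apply: (@Delta_comm _ eps); rewrite !inE eqxx ?orbT.
  by apply: sub_left_ideal_gen; left; left.
- apply: XT (cov_toric2 eps).
    by apply: commr_sym; apply: commrD; apply: commr_sym;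
      apply: (@Delta_comm _ eps); rewrite !inE eqxx ?orbT.
  by apply: sub_left_ideal_gen; left; right.
Qed.

End Conclusion.

Theorem proposition3p3 (R : realType) :
  generically (fun eps : R =>
    ideal_DIY eps `<=` gkz_res eps /\
    rat_extension (ideal_DIY eps) = rat_extension (gkz_res eps)).
Proof.
exists 1; first exact: oner_neq0.
by move=> eps _; split; [exact: DIY_sub_gkz_res|exact: rat_extension_eq].
Qed.
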